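(* Let $H$ be the complete $k$-uniform hypergraph on the vertex set $\{1,\dots,n\}$, and let $A=\mathbb{C}[x_1,\dots,x_n]/\{x_{i_1}\cdots x_{i_k}\mid \{i_1,\dots,i_k\}\text{ is a hyperedge of }H\}$. Then the dimension of the multilinear part of the $r$-th cyclic homology group of $A$ is $\binom{n-1}{r+1}$ for $n-k<r\le n-2$, and is $\binom{n-1}{n-k-1}+\binom{n-1}{n-k+1}$ for $r=n-k$.
   Context: A hypergraph on $\{1,\dots,n\}$ is complete $k$-uniform if its hyperedges are exactly the $k$-element subsets of $\{1,\dots,n\}$. The algebra $A$ is the quotient of the polynomial ring by the ideal generated by the listed monomials. Indexing convention and multilinear part: the multilinear part of the degree-$r$ chains ($r\ge -1$) has as basis the cyclic words $[D_1,\dots,D_{r+2}]$, where $D_1,\dots,D_{r+2}$ are nonconstant monomials that are nonzero in $A$, whose product is $x_1x_2\cdots x_n$ (each variable occurring exactly once in total), and where $x_1$ divides $D_1$. Cyclic words are taken modulo the signed cyclic relation $(D_1,\dots,D_{r+2})\sim(-1)^{r+1}(D_2,\dots,D_{r+2},D_1)$, and the representative with $x_1$ dividing $D_1$ is used. The boundary is $$\partial_r([D_1,\dots,D_{r+2}])=\sum_{i=1}^{r+1}(-1)^{i+1}[D_1,\dots,D_iD_{i+1},\dots,D_{r+2}]+(-1)^{r+3}[D_{r+2}D_1,D_2,\dots,D_{r+1}]$$ for $r\ge0$ (products taken in $A$, so a word with an entry equal to $0$ in $A$ is $0$), and $\partial_{-1}=0$. The multilinear part of the $r$-th cyclic homology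 group is $\ker\partial_r/\operatorname{im}\partial_{r+1}$ of this complex over $\mathbb{C}$. Thus the $r$-th group is indexed so that degree-$r$ chains have $r+2$ tensor factors. Binomial coefficients with negative lower index are $0$.
   Formalization: The hypothesis k ≥ 3 is added: for k ≤ 2 the formula at r = n−k fails in general; e.g. for k = 2, n = 4, r = 2 the dimension is 3! = 6, whereas the formula gives 4. *)

(* Defs.v *)
From HB Require Import structures.
From mathcomp Require Import all_boot all_order all_algebra.
From mathcomp Require Import boolp reals complex mpoly.

Set Implicit Arguments.
Unset Strict Implicit.
Unset Printing Implicit Defensive.

Import Order.TTheory GRing.Theory Num.Theory.
Local Open Scope ring_scope.

(* Binomial coefficient with an integer lower index, 0 when it is negative. *)
Definition binz (m : nat) (z : int) : nat :=
  if z is Posz j then 'C(m, j) else 0%N.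

(* Vertices (and variables) are indexed by 'I_n, so the variable called x_1 in
   the mathematics has index 0. *)
Definition hypergraph (n : nat) := {set {set 'I_n}}.

Definition complete_uniform (n k : nat) : hypergraph n :=
  [set e : {set 'I_n} | #|e| == k].

Section CyclicWords.

Variables (R : realType) (n : nat) (H : hypergraph n).

Definition edge_monomial (e : {set 'I_n}) : {mpoly R[i][n]} :=
  \prod_(i in e) 'X_i.

Definition edge_ideal (p : {mpoly R[i][n]}) : Prop :=
  exists c : {set 'I_n} -> {mpoly R[i][n]},
    p = \sum_(e in H) c e * edge_monomial e.

(* The monomial D is nonzero in A = C[x_1, ..., x_n] / edge_ideal. *)
Definition nonzero_in_A (D : 'X_{1..n}) : bool := `[< ~ edge_ideal 'X_[D] >].

Definition is_word (w : seq 'X_{1..n}) : bool :=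
  [&& all (fun D => (D != 0%MM) && nonzero_in_A D) w,
      \prod_(D <- w) 'X_[D] == \prod_(i < n) 'X_i :> {mpoly R[i][n]} &
      [forall i : 'I_n, (i == 0 :> nat) ==> (U_(i) <= head 0 w)%MM]].

(* Words with s letters.  A letter divides x_1 ... x_n, so restricting to
   monomials of degree < n.+1 loses nothing and makes the type finite. *)
Definition word (s : nat) :=
  {t : s.-tuple 'X_{1..n < n.+1} | is_word [seq bmnm D | D <- t]}.

Definition letters (s : nat) (w : word s) : seq 'X_{1..n} :=
  [seq bmnm D | D <- val w].

Definition chain (s : nat) := {ffun word s -> R[i]^o}.

(* The class of a sequence of s monomials: a basis vector, or 0 if the sequence
   is not a word.  For the sequences occurring in the boundary, the latter
   means that one of the entries is 0 in A. *)
Definition bracket (s : nat) (u : seq 'X_{1..n}) : chain s :=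
  [ffun w => (letters w == u)%:R].

(* [.., D_i D_(i+1), ..], counting from i = 0 *)
Definition merge_at (i : nat) (w : seq 'X_{1..n}) : seq 'X_{1..n} :=
  take i w ++ (nth 0%MM w i + nth 0%MM w i.+1)%MM :: drop i.+2 w.

(* [D_s D_1, D_2, .., D_(s-1)] *)
Definition merge_ends (w : seq 'X_{1..n}) : seq 'X_{1..n} :=
  (last 0%MM w + head 0%MM w)%MM :: take (size w).-2 (behead w).

(* Degree-r chains have s = r + 2 letters; s <= 1 is the case r = -1.  Signs
   are those of the 1-based formula, (-1)^(i+1) and (-1)^(r+3). *)
Definition word_boundary (s : nat) (w : seq 'X_{1..n}) : chain s.-1 :=
  if (s <= 1)%N then 0 else
    \sum_(i < s.-1) (-1) ^+ i *: bracket s.-1 (merge_at i w)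
    + (-1) ^+ s.+1 *: bracket s.-1 (merge_ends w).

Definition boundary_fun (s : nat) (c : chain s) : chain s.-1 :=
  \sum_(w : word s) (c w : R[i]) *: word_boundary s (letters w).

Lemma boundary_fun_linear (s : nat) : linear (@boundary_fun s).
Proof.
move=> a c d; rewrite /boundary_fun scaler_sumr -big_split /=.
by apply: eq_bigr => w _; rewrite !ffunE scalerDl scalerA.
Qed.

HB.instance Definition _ (s : nat) :=
  GRing.isLinear.Build R[i] (chain s) (chain s.-1) _ (@boundary_fun s)
    (@boundary_fun_linear s).

Definition boundary (s : nat) : 'Hom(chain s, chain s.-1) :=
  linfun (@boundary_fun s).

Lemma boundaryE (s : nat) (c : chain s) : boundary s c = boundary_fun c.
Proof. by rewrite lfunE. Qed.

(* U :\: V is a complement of U :&: V in U, so this is the dimension of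
   ker / im, chains in degree r >= -1 having r + 2 letters. *)
Definition cyclic_homology_dim (r : int) : nat :=
  let s := absz (r + 2) in
  \dim (lker (boundary s) :\: limg (boundary s.+1)).

End CyclicWords.

(* Main.v *)
(** The cyclic words with s letters are the (s-1)-dimensional cells of a torus:
    put n particles on a circle, up to rotation, and record which ones coincide
    and in which cyclic order they appear.  The words having a letter that is
    zero in A, i.e. a letter with at least k vertices, span the cellular complex
    of the union X of the subtori on which k coordinates coincide, so the
    homology in question is that of the pair (torus, X), with a shift by one.

    X has dimension n - k, so above that dimension only the torus contributes:
    its Betti numbers are bounded above by an acyclic matching on the cells
    ("split off the greatest vertex of the first letter with several vertices")
    and below by pairing the fundamental classes of coordinate subtori with
    cup products of coordinate 1-cocycles.  In the remaining degree the kernel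
    of H_(n-k)(X) -> H_(n-k)(torus) also contributes; H_(n-k)(X) has the
    fundamental classes of the subtori as a basis, because the top cells of one
    subtorus are connected to each other through cells of codimension one. *)
From HB Require Import structures.
Require Import Defs.
From mathcomp Require Import all_boot all_order all_fingroup all_algebra.
From mathcomp Require Import boolp reals complex mpoly zify.

Set Implicit Arguments.
Unset Strict Implicit.
Unset Printing Implicit Defensive.

Import Order.TTheory GRing.Theory Num.Theory.
Local Open Scope ring_scope.

(** The second binomial coefficient counts the [k]-subsets of the vertices that avoid the vertex of
    [x_1]. Subtori whose coinciding set contains that vertex are coordinate subtori, and their
    classes already form a basis of the homology of the torus in degree n - k. So the map from the
    homology of X is onto, and its kernel has one dimension for each remaining subtorus. Both
    families have sorted representatives, with the big letter at position 0 or at position 1.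

    The two bounds for the torus are not matched class by class: both are governed by the number of
    sorted words, and rank-nullity forces equality in every degree. A cycle is then a boundary
    exactly when its periods vanish, which turns the kernel computation into linear algebra on
    periods.

    Three vertices in the big letter make it recognizable in a face that merges two single vertices.
    Alternating chains are cycles because certain sums equal their own opposite, whence the passage
    to [numFieldType]. *)

(** * Dimensions from triangular and dual families *)

Section Dimension.

Variables (F : fieldType) (V : vectType F) (I : finType).
Implicit Types (U : {vspace V}) (e : I -> 'Hom(V, F^o)) (x : I -> V).

Definition lincomb_fun x (a : {ffun I -> F^o}) : V := \sum_i (a i : F) *: x i.

Lemma lincomb_fun_linear x : linear (lincomb_fun x).
Proof.
move=> t a b; rewrite /lincomb_fun scaler_sumr -big_split /=.
by apply: eq_bigr => i _; rewrite !ffunE scalerDl scalerA.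
Qed.

HB.instance Definition _ x :=
  GRing.isLinear.Build F {ffun I -> F^o} V _ (lincomb_fun x)
    (lincomb_fun_linear x).

Definition values_fun e (c : V) : {ffun I -> F^o} := [ffun i => e i c].

Lemma values_fun_linear e : linear (values_fun e).
Proof. by move=> t c d; apply/ffunP => i; rewrite !ffunE linearP. Qed.

HB.instance Definition _ e :=
  GRing.isLinear.Build F V {ffun I -> F^o} _ (values_fun e)
    (values_fun_linear e).

Definition values e : 'Hom(V, {ffun I -> F^o}) := linfun (values_fun e).

Lemma valuesE e c i : values e c i = e i c.
Proof. by rewrite lfunE /= ffunE. Qed.

Lemma dim_scalar_ffun : \dim (fullv : {vspace {ffun I -> F^o}}) = #|I|.
Proof. by rewrite dimvf /= /dim /= muln1. Qed.

(** In a vanishing combination take, among the indices with nonzero coefficient, one with [o]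
    greatest: its functional sees that term alone. So the [x i] are independent. *)
Lemma card_le_dim_triangular U e x (o : I -> nat) :
  (forall i, x i \in U) -> (forall i, e i (x i) != 0) ->
  (forall i j, e i (x j) != 0 -> j = i \/ (o i < o j)%N) ->
  (#|I| <= \dim U)%N.
Proof.
move=> xU e_diag e_tri; pose f := linfun (lincomb_fun x).
have sub : (limg f <= U)%VS.
  apply/subvP => _ /memv_imgP[a _ ->]; rewrite lfunE /=.
  by apply: memv_suml => i _; apply: memvZ.
suff kerf : (fullv :&: lker f = 0)%VS.
  by rewrite -dim_scalar_ffun -(limg_dim_eq kerf) dimvS.
apply/eqP; rewrite -subv0; apply/subvP => a; rewrite memv_cap memvf /= memv_ker.
rewrite memv0 => /eqP fa0; apply/negPn/negP => a_neq0.
have [i0 ai0] : exists i, a i != 0.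
  apply/existsP; apply: contraNT a_neq0 => /existsPn a0.
  by apply/eqP/ffunP => i; rewrite ffunE; apply/eqP/negPn.
case: (arg_maxnP (P := [pred i | a i != 0]) o ai0) => i /= ai_neq0 imax.
have := congr1 (e i) fa0; rewrite lfunE /= /lincomb_fun linear_sum linear0 /=.
rewrite (bigD1 i) //= big1 ?addr0 => [|j neq_ji].
  by rewrite linearZ /= => /eqP; rewrite mulf_eq0 (negPf ai_neq0) (negPf (e_diag i)).
rewrite linearZ /=; apply/eqP; rewrite mulf_eq0; apply/norP => -[aj eij].
case: (e_tri _ _ eij) => [ji|]; first by rewrite ji eqxx in neq_ji.
by rewrite ltnNge imax.
Qed.

(** A dual family makes [values e] map [U] onto all functions on [I]; the rest is rank-nullity. *)
Lemma dim_cap_values U e x :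
  (forall i, x i \in U) -> (forall i j, e i (x j) = (i == j)%:R) ->
  (\dim (U :&: lker (values e)) + #|I|)%N = \dim U.
Proof.
move=> xU ex; rewrite -(limg_ker_dim (values e) U); congr (_ + _)%N.
rewrite -dim_scalar_ffun; congr (\dim _); apply/eqP; rewrite eqEsubv subvf andbT.
apply/subvP => a _; apply/memv_imgP; exists (\sum_i (a i : F) *: x i).
  by apply: memv_suml => i _; apply: memvZ.
apply/ffunP => j; rewrite valuesE linear_sum (bigD1 j) //= big1 => [|i ij].
  by rewrite addr0 linearZ /= ex eqxx /= /GRing.scale /= mulr1.
by rewrite linearZ /= ex eq_sym (negPf ij) scaler0.
Qed.

Lemma dim_values U e x :
  (forall i, x i \in U) -> (forall i j, e i (x j) = (i == j)%:R) ->
  (forall c, c \in U -> (forall i, e i c = 0) -> c = 0) -> \dim U = #|I|.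
Proof.
move=> xU ex e_inj; rewrite -(dim_cap_values xU ex).
suff -> : (U :&: lker (values e) = 0)%VS by rewrite dimv0.
apply/eqP; rewrite -subv0; apply/subvP => c; rewrite memv_cap memv_ker memv0.
case/andP=> cU /eqP ec; apply/eqP/e_inj => // i.
by rewrite -valuesE ec ffunE.
Qed.

End Dimension.

(** * The complex of all words *)

(* A cyclic word with s letters on the vertices 0, .., n is encoded by the map
   sending a vertex to the position of the letter containing it. *)
Definition placement (n : nat) := {ffun 'I_n.+1 -> 'I_n.+1}.

Section Placements.

Variable n : nat.
Implicit Types (f g h : placement n) (s t i j : nat) (u v w : 'I_n.+1).

Definition onto s : {set placement n} :=
  [set f : placement n | [&& f ord0 == ord0, [forall v, f v < s]%N
             & [forall j : 'I_s, [exists v, f v == j :> nat]]]].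

Lemma ontoP s f :
  reflect [/\ f ord0 = ord0, (forall v, (f v < s)%N)
            & forall j, (j < s)%N -> exists v, f v = j :> nat]
          (f \in onto s).
Proof.
rewrite inE; apply: (iffP and3P) => [[/eqP f0 /forallP fs /forallP fj]|[f0 fs fj]].
  split=> // j js; have /existsP[v /eqP vj] := fj (Ordinal js).
  by exists v.
split; first exact/eqP.
  exact/forallP.
by apply/forallP => j; have [v vj] := fj j (ltn_ord j); apply/existsP; exists v; apply/eqP.
Qed.

Lemma onto_lt s f v : f \in onto s -> (f v < s)%N.
Proof. by case/ontoP. Qed.

Lemma onto_0 s f : f \in onto s -> f ord0 = ord0.
Proof. by case/ontoP. Qed.

Lemma onto_ex s f j : f \in onto s -> (j < s)%N -> exists v, f v = j :> nat.
Proof. by case/ontoP => _ _; apply. Qed.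

Lemma onto_gt0 s f : f \in onto s -> (0 < s)%N.
Proof. by move=> fs; apply: leq_ltn_trans (onto_lt ord0 fs). Qed.

Lemma onto_le s f : f \in onto s -> (s <= n.+1)%N.
Proof. by case: s => // s /onto_ex /(_ (ltnSn s)) [v <-]. Qed.

(* The face i of a word with t.+1 letters merges the letters in positions i and
   i.+1; when i = t, the reduction modulo t merges the last letter with the
   first one. *)
Definition face t i f : placement n := [ffun v => inord (unbump i (f v) %% t)].

Lemma faceE t i f v :
  f \in onto t.+1 -> (0 < t)%N -> face t i f v = (unbump i (f v) %% t)%N :> nat.
Proof.
move=> /onto_le tn t_gt0; rewrite ffunE inordK //.
by apply: leq_trans (ltn_pmod _ t_gt0) _; lia.
Qed.

Lemma face_inner t i f v :
  f \in onto t.+1 -> (i < t)%N -> face t i f v = (f v - (i < f v))%N :> nat.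
Proof.
move=> fW it; have fv := onto_lt v fW; rewrite faceE //; last lia.
by rewrite /unbump modn_small //; lia.
Qed.

Lemma face_last t f v :
  f \in onto t.+1 -> (0 < t)%N ->
  face t t f v = (if f v == t :> nat then 0 else f v)%N :> nat.
Proof.
move=> fW t_gt0; have fv := onto_lt v fW; rewrite faceE // /unbump.
by case: eqP => [->|ne]; rewrite ?ltnn ?subn0 ?modnn // modn_small; lia.
Qed.

Lemma face_onto t i f :
  f \in onto t.+1 -> (0 < t)%N -> (i <= t)%N -> face t i f \in onto t.
Proof.
move=> fW t_gt0 it; apply/ontoP; split=> [|v|j jt].
- by apply/val_inj; rewrite /= faceE // (onto_0 fW) /= /unbump ltn0 mod0n.
- by rewrite faceE // ltn_pmod.
move: it; rewrite leq_eqVlt => /orP[/eqP ->|it].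
  have [|v fv] := onto_ex (j := j) fW; first lia.
  by exists v; rewrite face_last // fv; case: eqP => //; lia.
have [|v fv] := onto_ex (j := (j + (i < j))%N) fW; first lia.
by exists v; rewrite face_inner // fv; lia.
Qed.

(** The simplicial identity; the face merging the last letter into the first obeys it as well. *)
Lemma face_face t i j f :
  f \in onto t.+2 -> (0 < t)%N -> (i < j)%N -> (j <= t.+1)%N ->
  face t i (face t.+1 j f) = face t j.-1 (face t.+1 i f).
Proof.
move=> fW t_gt0 ij jt; apply/ffunP => v; apply/val_inj => /=.
have fv := onto_lt v fW.
have fj : face t.+1 j f \in onto t.+1 by apply: face_onto.
have fi : face t.+1 i f \in onto t.+1 by apply: face_onto => //; lia.
move: jt; rewrite leq_eqVlt => /orP[/eqP jt|jt]; last first.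
  rewrite (face_inner _ fi) ?(face_inner _ fW); [|lia..].
  have [it|ti] := ltnP i t; last lia.
  by rewrite (face_inner _ fj) ?(face_inner _ fW); lia.
subst j; rewrite (face_last _ fi) // (face_inner _ fW) //=.
move: ij; rewrite ltnS leq_eqVlt => /orP[/eqP it|it].
  subst i; rewrite (face_last _ fj) // (face_last _ fW) //.
  by do !case: eqP; lia.
rewrite (face_inner _ fj) // (face_last _ fW) //.
by do !case: eqP; lia.
Qed.

End Placements.

(** * Chains of placements and their boundary *)

Section Boundary.

Variables (F : fieldType) (n : nat).
Implicit Types (f g h : placement n) (s t i j : nat) (u v w : 'I_n.+1).

(** One ambient space serves words of all lengths; the length is recorded by the support, so that
    chain spaces are subspaces and not a dependent family. *)
Definition placement_chain := {ffun placement n -> F^o}.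
Implicit Types (c : placement_chain) (P Q : {set placement n}).

Definition point f : placement_chain := [ffun g => (f == g)%:R].

Definition eval_fun f c : F^o := c f.

Lemma eval_fun_linear f : linear (eval_fun f).
Proof. by move=> a c d; rewrite /eval_fun !ffunE. Qed.

HB.instance Definition _ f :=
  GRing.isLinear.Build F placement_chain F^o _ (eval_fun f) (eval_fun_linear f).

Definition eval f : 'Hom(placement_chain, F^o) := linfun (eval_fun f).

Lemma evalE f c : eval f c = c f. Proof. by rewrite lfunE. Qed.

Definition cut_fun P c : placement_chain := [ffun f => if f \in P then 0 else c f].

Lemma cut_fun_linear P : linear (cut_fun P).
Proof.
by move=> a c d; apply/ffunP => f; rewrite !ffunE; case: ifP; rewrite ?scaler0 ?addr0.
Qed.

HB.instance Definition _ P :=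
  GRing.isLinear.Build F placement_chain placement_chain _ (cut_fun P) (cut_fun_linear P).

Definition supported P : {vspace placement_chain} := lker (linfun (cut_fun P)).

Lemma supportedP P c :
  reflect (forall f, f \notin P -> c f = 0) (c \in supported P).
Proof.
rewrite memv_ker lfunE /=; apply: (iffP eqP) => [/ffunP cP f fP|cP].
  by have := cP f; rewrite !ffunE (negPf fP).
by apply/ffunP => f; rewrite !ffunE; case: ifPn => // /cP.
Qed.

Lemma supportedS P Q : P \subset Q -> (supported P <= supported Q)%VS.
Proof.
move=> PQ; apply/subvP => c /supportedP cP; apply/supportedP => f fQ.
by apply: cP; apply: contraNN fQ; apply: (subsetP PQ).
Qed.

Lemma dim_supported P : \dim (supported P) = #|P|.
Proof.
rewrite -[RHS]card_sig; pose I : finType := {f | f \in P}.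
apply: (@dim_values F placement_chain I (supported P) (fun q : I => eval (val q))
          (fun q : I => point (val q))).
- move=> [f fP] /=; apply/supportedP => g; rewrite ffunE; case: eqP => [<-|//].
  by rewrite fP.
- by move=> i j; rewrite evalE ffunE eq_sym.
move=> c /supportedP cP c0; apply/ffunP => f; rewrite ffunE.
have [fP|/cP//] := boolP (f \in P).
by have := c0 (exist _ f fP); rewrite evalE.
Qed.

(* The coefficients of the boundary are only recorded on Q: the complex of the
   algebra is the quotient of the complex of all placements by the span of the
   words having a letter that vanishes in the algebra. *)
Definition bd_fun t Q c : placement_chain :=
  [ffun g => if g \in Q then
     \sum_(i < t.+1) (-1) ^+ i * (\sum_(f in onto n t.+1 | face t i f == g) c f : F)
   else 0].

Lemma bd_fun_linear t Q : linear (bd_fun t Q).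
Proof.
move=> a c d; apply/ffunP => g; rewrite !ffunE; case: ifP => _; last first.
  by rewrite scaler0 addr0.
rewrite /GRing.scale /= mulr_sumr -big_split /=; apply: eq_bigr => i _.
rewrite mulrCA -mulrDr; congr (_ * _); rewrite mulr_sumr -big_split /=.
by apply: eq_bigr => f _; rewrite !ffunE.
Qed.

HB.instance Definition _ t Q :=
  GRing.isLinear.Build F placement_chain placement_chain _ (bd_fun t Q) (bd_fun_linear t Q).

Definition bd t Q : 'End(placement_chain) := linfun (bd_fun t Q).

Lemma bdE t Q c g : bd t Q c g = if g \in Q then
     \sum_(i < t.+1) (-1) ^+ i * (\sum_(f in onto n t.+1 | face t i f == g) c f : F)
   else 0.
Proof. by rewrite lfunE /= ffunE. Qed.

Lemma bd_supported t Q c : bd t Q c \in supported Q.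
Proof. by apply/supportedP => g gQ; rewrite bdE (negPf gQ). Qed.

(** The terms with [i < j] are carried to those with [j <= i] by (i, j) -> (j - 1, i), which
    reverses the sign. *)
Lemma alternating_sum_cancel t (G : nat -> nat -> F) :
  (forall i j, (i < j)%N -> (j <= t.+1)%N -> G i j = G j.-1 i) ->
  \sum_(i < t.+1) \sum_(j < t.+2) (-1) ^+ (i + j) * G i j = 0.
Proof.
move=> GC.
pose lo (i j : nat) : F := if (j <= i)%N then (-1) ^+ (i + j) * G i j else 0.
transitivity (\sum_(i < t.+1) (\sum_(j < t.+1) lo i j - \sum_(j < t.+1) lo j i)).
  apply: eq_bigr => i _.
  rewrite (eq_bigr (fun j : 'I_t.+2 =>
      lo i j + (if (i < j)%N then (-1) ^+ (i + j) * G i j else 0))); last first.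
    by move=> j _; rewrite /lo ltnNge; case: leqP; rewrite ?addr0 ?add0r.
  rewrite big_split /= big_ord_recr /= /lo leqNgt ltn_ord /= addr0.
  congr (_ + _); rewrite big_ord_recl /= add0r -sumrN; apply: eq_bigr => j _.
  rewrite /bump leq0n add1n ltnS; case: ifP => [ij|]; last by rewrite oppr0.
  by rewrite GC //= addnS exprS mulN1r mulNr addnC.
by rewrite sumrB [X in _ - X]exchange_big /= subrr.
Qed.

Lemma sum_over_face t i j g c :
  (0 < t)%N -> (j <= t.+1)%N ->
  \sum_(h in onto n t.+1 | face t i h == g)
     \sum_(f in onto n t.+2 | face t.+1 j f == h) (c f : F) =
  \sum_(f in onto n t.+2 | face t i (face t.+1 j f) == g) (c f : F).
Proof.
move=> t_gt0 jt.
rewrite [RHS](partition_big (face t.+1 j)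
  (fun h => (h \in onto n t.+1) && (face t i h == g))) /=; last first.
  by move=> f /andP[fW ->]; rewrite face_onto.
apply: eq_bigr => h /andP[hW hg]; apply: eq_bigl => f.
by case: eqP => [->|]; rewrite ?hg ?andbT ?andbF.
Qed.

Lemma bd_bd t c : bd t (onto n t) (bd t.+1 (onto n t.+1) c) = 0.
Proof.
apply/ffunP => g; rewrite bdE !ffunE; case: ifP => // gW.
have t_gt0 := onto_gt0 gW.
rewrite -[RHS](@alternating_sum_cancel t (fun i j =>
   \sum_(f in onto n t.+2 | face t i (face t.+1 j f) == g) (c f : F))).
  apply: eq_bigr => i _; rewrite mulr_sumr.
  rewrite (eq_bigr (fun h => \sum_(j < t.+2) (-1) ^+ (i + j) *
      (\sum_(f in onto n t.+2 | face t.+1 j f == h) (c f : F)))); last first.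
    move=> h /andP[hW _]; rewrite bdE hW mulr_sumr; apply: eq_bigr => j _.
    by rewrite exprD mulrA.
  rewrite exchange_big /=; apply: eq_bigr => j _.
  by rewrite -mulr_sumr sum_over_face // -ltnS.
move=> i j ij jt; apply: eq_bigl => f; apply: andb_id2l => fW.
by rewrite face_face.
Qed.

Lemma bd_restrict t Q c g :
  Q \subset onto n t -> bd t Q c g = if g \in Q then bd t (onto n t) c g else 0.
Proof. by move=> /subsetP QW; rewrite !bdE; case: ifP => // /QW ->. Qed.

Lemma bd_bd_sub t Q c : Q \subset onto n t -> bd t Q (bd t.+1 (onto n t.+1) c) = 0.
Proof.
by move=> QW; apply/ffunP => g; rewrite bd_restrict // bd_bd ffunE if_same.
Qed.

End Boundary.

(** * Sorted words *)

Section Sorted.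

Variable n : nat.
Implicit Types (f g h : placement n) (s t i j p : nat) (u v w : 'I_n.+1).
Implicit Types I : {set 'I_n.+1}.

Definition sorted_above p f : bool :=
  [forall u, forall v, (p < f u <= f v)%N ==> (u <= v)%N].

Lemma sorted_aboveP p f :
  reflect (forall u v, (p < f u)%N -> (f u <= f v)%N -> (u <= v)%N)
          (sorted_above p f).
Proof.
apply: (iffP 'forall_forallP) => [srt u v pu uv|srt u v].
  by have /implyP := srt u v; apply; rewrite pu.
by apply/implyP => /andP[]; apply: srt.
Qed.

Lemma sorted_above_inj p f u v :
  sorted_above p f -> (p < f u)%N -> f u = f v -> u = v.
Proof.
move=> /sorted_aboveP srt pu uv; apply/val_inj/eqP; rewrite eqn_leq /=.
by apply/andP; split; apply: srt; rewrite -?uv.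
Qed.

Definition above p f : {set 'I_n.+1} := [set u | (p < f u)%N].

Lemma card_interval p q : (q <= n)%N ->
  #|[set j : 'I_n.+1 | (p < j <= q)%N]| = (q - p)%N.
Proof.
move=> qn; rewrite -[RHS]card_ord.
rewrite -(card_imset (f := fun k : 'I_(q - p) => inord (p + k.+1) : 'I_n.+1)).
  apply: eq_card => j; rewrite inE; apply/idP/imsetP => [/andP[pj jq]|[k _ ->]].
    have kq : (j - p.+1 < q - p)%N by lia.
    by exists (Ordinal kq) => //; apply/val_inj; rewrite /= inordK; lia.
  by rewrite inordK; have := ltn_ord k; lia.
move=> k l /(congr1 val) /=; have := ltn_ord k; have := ltn_ord l => lk ll.
by rewrite !inordK => [kl||]; [apply/val_inj => /=; lia|lia..].
Qed.

(** Beyond [p] the letters are single vertices in increasing order, so the vertices of [above p f]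
    up to [v] fill the positions from [p + 1] to [f v]. Hence [above p f] determines a sorted
    word. *)
Lemma sorted_above_rank s p f v :
  f \in onto n s -> sorted_above p f -> (p < f v)%N ->
  (f v = p + #|[set u in above p f | u <= v]| :> nat)%N.
Proof.
move=> fW srt pv; have := card_interval p (leq_ord (f v)).
have -> : [set j : 'I_n.+1 | (p < j <= f v)%N] =
          f @: [set u in above p f | (u <= v)%N].
  apply/setP => j; rewrite inE; apply/andP/imsetP => [[pj jv]|[u]].
    have [|u fu] := onto_ex (j := j) fW; first exact: leq_ltn_trans jv (onto_lt v fW).
    exists u; last by apply/val_inj; rewrite /= fu.
    by rewrite !inE fu pj /=; apply: (sorted_aboveP _ _ srt); rewrite fu.
  rewrite !inE => /andP[pu uv] ->; split=> //; rewrite leqNgt; apply/negP => vu.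
  have vu' := sorted_aboveP _ _ srt _ _ pv (ltnW vu).
  have e : u = v by apply/val_inj/eqP; rewrite eqn_leq /= uv vu'.
  by rewrite e ltnn in vu.
rewrite card_in_imset; last first.
  by move=> u w; rewrite !inE => /andP[pu _] _; apply: (sorted_above_inj srt).
by move=> ->; lia.
Qed.

(* Only p = 0 and p = 1 are used: for p = 0 all letters but the first one are
   single vertices, in increasing order; for p = 1 the first letter is the
   vertex 0, and all letters but the second one are single vertices. *)
Definition sorted_words p s : {set placement n} :=
  [set f in onto n s | sorted_above p f && [forall v, (f v < p)%N ==> (v == ord0)]].

Lemma sorted_wordsP p s f :
  reflect [/\ f \in onto n s, sorted_above p f & forall v, (f v < p)%N -> v = ord0]
          (f \in sorted_words p s).
Proof.
rewrite [f \in sorted_words _ _]in_set; apply: (iffP and3P) => -[fW srt z]; split=> //.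
  by move=> v fv; have /forallP/(_ v)/implyP/(_ fv)/eqP := z.
by apply/forallP => v; apply/implyP => /z ->.
Qed.

Lemma card_above p s f : f \in sorted_words p s -> (p < s)%N ->
  #|above p f| = (s - p.+1)%N.
Proof.
case/sorted_wordsP=> fW srt _ ps; have [sp|sp] := leqP s p.+1.
  rewrite (_ : s - p.+1 = 0)%N; last lia.
  apply: eq_card0 => u; rewrite inE; have fu := onto_lt u fW.
  by apply/negbTE; rewrite -leqNgt; lia.
have [|v fv] := onto_ex (j := s.-1) fW; first lia.
have := sorted_above_rank fW srt (v := v); rewrite fv => /(_ ltac:(lia)).
rewrite (_ : [set u in above p f | (u <= v)%N] = above p f); first lia.
apply/setP => u; rewrite !inE; case: (ltnP p (f u)) => //= pu.
by apply: (sorted_aboveP _ _ srt) => //; have := onto_lt u fW; lia.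
Qed.

(** Inverse of [above p]; it reduces counting sorted words to counting sets of vertices other than
    [ord0]. *)
Definition sorted_word_of p I : placement n :=
  [ffun v => inord (if v \in I then p + #|[set u in I | (u <= v)%N]|
                    else if v == ord0 then 0 else p)%N].

Lemma sorted_word_ofK p s f : (p <= 1)%N ->
  f \in sorted_words p s -> sorted_word_of p (above p f) = f.
Proof.
move=> p1 /sorted_wordsP[fW srt z]; apply/ffunP => v; rewrite ffunE.
apply/val_inj => /=; rewrite [v \in _]inE; case: ltnP => pv.
  by rewrite -(sorted_above_rank fW srt pv) inordK.
case: eqP => [->|v0]; first by rewrite (onto_0 fW) inordK.
have fv : f v = p :> nat.
  by apply/eqP; rewrite eqn_leq pv leqNgt; apply/negP => /z.
by rewrite -fv inordK.
Qed.

Lemma above_inj p s f g : (p <= 1)%N -> f \in sorted_words p s ->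
  g \in sorted_words p s -> above p f = above p g -> f = g.
Proof.
by move=> p1 fS gS fg; rewrite -(sorted_word_ofK p1 fS) fg (sorted_word_ofK p1 gS).
Qed.

Section SortedWordOf.

Variables (p s : nat) (I : {set 'I_n.+1}).
Hypotheses (p_le1 : (p <= 1)%N) (ps : (p < s)%N) (sn : (s <= n.+1)%N).
Hypotheses (I0 : ord0 \notin I) (I_card : #|I| = (s - p.+1)%N).
Let r v := #|[set u in I | (u <= v)%N]|.

Let r_gt0 v : v \in I -> (0 < r v)%N.
Proof. by move=> vI; apply/card_gt0P; exists v; rewrite inE vI leqnn. Qed.

Let r_le v : (r v <= s - p.+1)%N.
Proof.
rewrite -I_card; apply: subset_leq_card; apply/subsetP => u.
by rewrite inE => /andP[].
Qed.

Let r_mono u v : v \in I -> (u < v)%N -> (r u < r v)%N.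
Proof.
move=> vI uv; apply: proper_card; apply/properP; split.
  by apply/subsetP => w; rewrite !inE => /andP[-> /=]; lia.
by exists v; rewrite !inE vI ?leqnn // -ltnNge.
Qed.

Let wordE v : sorted_word_of p I v =
  (if v \in I then p + r v else if v == ord0 then 0 else p)%N :> nat.
Proof.
rewrite ffunE inordK //; have := r_le v.
by case: ifP => _; [|case: ifP => _]; rewrite /r; lia.
Qed.

Lemma above_sorted_word_of : above p (sorted_word_of p I) = I.
Proof.
apply/setP => v; rewrite inE wordE; case: ifP => [/r_gt0|_]; first lia.
by case: eqP => _; rewrite ?ltnn.
Qed.

Lemma sorted_word_of_mem : sorted_word_of p I \in sorted_words p s.
Proof.
apply/sorted_wordsP; split.
- apply/ontoP; split=> [|v|j js].
  + by apply/val_inj; rewrite /= wordE (negPf I0) eqxx.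
  + by rewrite wordE; have := r_le v; case: ifP => _; [|case: ifP => _]; lia.
  case: (posnP j) => [->|j_gt0].
    by exists ord0; rewrite wordE (negPf I0) eqxx.
  have [jp|pj] := leqP j p.
    (* Here [p = j = 1]: position 1 is filled by any vertex outside [ord0 |: I], a set with only
       [s - 1] elements. *)
    have [v] : exists v, v \notin ord0 |: I.
      apply/existsP; rewrite -negb_forall; apply/negP => /forallP allI.
      have := max_card (mem (ord0 |: I)); rewrite card_ord.
      have : #|ord0 |: I| = n.+1.
        by rewrite -[RHS]card_ord; apply: eq_card => v; rewrite allI.
      by rewrite cardsU1 I0 I_card; lia.
    rewrite !inE negb_or => /andP[v0 vI]; exists v.
    by rewrite wordE (negPf v0) (negPf vI); lia.
  pose R v : 'I_n.+1 := inord (r v).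
  have RE v : R v = r v :> nat by rewrite /R inordK //; have := r_le v; lia.
  have R_inj : {in I &, injective R}.
    move=> u v uI vI /(congr1 val) /=; rewrite !RE => uv; apply/val_inj.
    by case: (ltngtP u v) => // lt; have := r_mono _ lt; rewrite ?uI ?vI uv ltnn => /(_ isT).
  have RI : R @: I = [set i : 'I_n.+1 | (0 < i <= s - p.+1)%N].
    apply/eqP; rewrite eqEcard card_in_imset // card_interval; last lia.
    rewrite I_card subn0 leqnn andbT; apply/subsetP => _ /imsetP[v vI ->].
    by rewrite inE RE r_gt0 // r_le.
  have : (inord (j - p) : 'I_n.+1) \in R @: I by rewrite RI inE inordK; lia.
  case/imsetP=> v vI /(congr1 val) /=; rewrite RE inordK; last lia.
  by move=> rv; exists v; rewrite wordE vI -rv; lia.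
- apply/sorted_aboveP => u v; rewrite !wordE.
  case: ifPn => uI; last by case: eqP => _; lia.
  case: ifPn => vI; last by have := r_gt0 uI; case: eqP => _; lia.
  by move=> _ uv; rewrite leqNgt; apply/negP => /(r_mono uI); lia.
move=> v; rewrite wordE; case: ifP => _; first lia.
by case: eqP => //; rewrite ltnn.
Qed.

End SortedWordOf.

Lemma card_sorted_words p s : (p <= 1)%N -> (p < s)%N -> (s <= n.+1)%N ->
  #|sorted_words p s| = 'C(n, s - p.+1).
Proof.
move=> p1 ps sn.
have -> : 'C(n, s - p.+1) =
    #|[set I : {set 'I_n.+1} | I \subset [set~ ord0] & #|I| == (s - p.+1)%N]|.
  by rewrite cards_draws cardsC1 card_ord.
rewrite -(card_in_imset (f := above p) (D := mem (sorted_words p s))); last first.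
  by move=> f g; apply: above_inj.
apply: eq_card => I; rewrite inE; apply/imsetP/andP => [[f fS ->]|[I0 /eqP Ic]].
  split; last by rewrite (card_above fS).
  apply/subsetP => v; rewrite !inE; apply: contraTneq => ->.
  by case/sorted_wordsP: fS => /onto_0 -> _ _; rewrite ltn0.
have {}I0 : ord0 \notin I.
  by apply/negP => /(subsetP I0); rewrite !inE eqxx.
exists (sorted_word_of p I); first exact: (sorted_word_of_mem p1 ps sn I0 Ic).
by rewrite (above_sorted_word_of p1 ps sn I0 Ic).
Qed.

(** With fewer positions than vertices two vertices coincide, and only letter [p] of a sorted word
    has room for two. *)
Lemma sorted_words_collision p s f : f \in sorted_words p s -> (s <= n)%N ->
  exists u v, [/\ u != v, f u = p :> nat & f v = p :> nat].
Proof.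
case/sorted_wordsP=> fW srt z sn.
have /injectivePn[u [v uv fuv]] : ~~ injectiveb f.
  apply/negP => /injectiveP f_inj.
  have := @leq_card _ _ (fun v => Ordinal (onto_lt v fW)); rewrite !card_ord.
  suff inj : injective (fun v => Ordinal (onto_lt v fW)) by move/(_ inj); lia.
  by move=> u v /(congr1 val) /= uv; apply/f_inj/val_inj.
have fup : f u = p :> nat.
  case: (ltngtP (f u) p) => // [up|pu]; last first.
    by rewrite (sorted_above_inj srt pu fuv) eqxx in uv.
  by move: uv; rewrite (z _ up) [v]z ?eqxx // -fuv.
by exists u, v; rewrite -fuv.
Qed.

End Sorted.

(** * Cocycles and alternating cycles *)

Section Cocycles.

Variables (F : fieldType) (n : nat).
Implicit Types (f g h : placement n) (s t i j : nat) (u v w : 'I_n.+1).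
Implicit Types c : placement_chain F n.

(** For a sorted [h] (with [p = 0]) this cochain is the cup product of the coordinate 1-cocycles of
    the vertices in [above 0 h], in increasing order. *)
Definition matches h f : bool := [forall v, (0 < h v)%N ==> (f v == h v)].

Lemma matchesP h f :
  reflect (forall v, (0 < h v)%N -> f v = h v) (matches h f).
Proof.
apply: (iffP forallP) => hf v; first by move=> h0; apply/eqP/(implyP (hf v)).
by apply/implyP => h0; rewrite hf.
Qed.

(* A face matches h exactly when f agrees with h below some position i and with
   h + 1 above it, and the two faces adjacent to such a position cancel. *)
Definition matches_shift i h f : bool :=
  [forall v, (0 < h v)%N ==> (f v == (h v + (i < h v))%N :> nat)].

Lemma matches_shiftP i h f :
  reflect (forall v, (0 < h v)%N -> f v = (h v + (i < h v))%N :> nat)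
          (matches_shift i h f).
Proof.
apply: (iffP forallP) => hf v; first by move=> h0; apply/eqP/(implyP (hf v)).
by apply/implyP => h0; rewrite hf.
Qed.

Lemma matches_face_0 t h f : f \in onto n t.+1 -> (0 < t)%N ->
  matches h (face t 0 f) = matches_shift 0 h f.
Proof.
move=> fW t_gt0; apply/matchesP/matches_shiftP => hf v h0.
  by have /(congr1 val) /= := hf v h0; rewrite face_inner //; lia.
by apply/val_inj; rewrite /= face_inner // hf //; lia.
Qed.

Lemma matches_face_last t h f : f \in onto n t.+1 -> h \in onto n t -> (0 < t)%N ->
  matches h (face t t f) = matches_shift t.-1 h f.
Proof.
move=> fW hW t_gt0; apply/matchesP/matches_shiftP => hf v h0; have ht := onto_lt v hW.
  by have /(congr1 val) /= := hf v h0; rewrite face_last //; case: eqP; lia.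
apply/val_inj; rewrite /= face_last // hf //.
by case: eqP; lia.
Qed.

(** The single vertex that [h] has at position [i] sits in [f] at [i] or at [i + 1]; these exclusive
    cases are the two shifts. *)
Lemma matches_face_inner t i h f : f \in onto n t.+1 -> h \in sorted_words n 0 t ->
  (0 < i < t)%N ->
  (matches h (face t i f))%:R =
  (matches_shift i h f)%:R + (matches_shift i.-1 h f)%:R :> F.
Proof.
move=> fW /sorted_wordsP[hW srt _] /andP[i_gt0 it].
have [w hw] := onto_ex hW it.
have -> : matches h (face t i f) = matches_shift i h f || matches_shift i.-1 h f.
  apply/matchesP/orP => [hf|hf v h0].
    have /(congr1 val) /= := hf w ltac:(lia); rewrite face_inner // => fw.
    have [fwi|fwi] := leqP (f w) i; [left|right]; apply/matches_shiftP => v h0.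
      case: (eqVneq (h v) (h w)) => [/(sorted_above_inj srt h0) -> |]; first lia.
      rewrite -val_eqE /= => hvw.
      by have /(congr1 val) /= := hf v h0; rewrite face_inner //; lia.
    case: (eqVneq (h v) (h w)) => [/(sorted_above_inj srt h0) -> |]; first lia.
    rewrite -val_eqE /= => hvw.
    by have /(congr1 val) /= := hf v h0; rewrite face_inner //; lia.
  apply/val_inj; rewrite /= face_inner //.
  by case: hf => /matches_shiftP/(_ v h0); lia.
have : ~~ (matches_shift i h f && matches_shift i.-1 h f).
  apply/negP => /andP[/matches_shiftP/(_ w) h1 /matches_shiftP/(_ w) h2].
  by move: (h1 ltac:(lia)) (h2 ltac:(lia)); lia.
by do 2!case: matches_shift; rewrite //= ?addr0 ?add0r.
Qed.

Lemma sum_matches_face t h f : f \in onto n t.+1 -> h \in sorted_words n 0 t ->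
  (0 < t)%N -> \sum_(i < t.+1) (-1) ^+ i * (matches h (face t i f))%:R = 0 :> F.
Proof.
move=> fW hS t_gt0; have /sorted_wordsP[hW _ _] := hS.
(* The face [i] contributes [a i - a i.+1], and [a] vanishes at both ends, [0] and [t + 1]. *)
pose a i : F := if (0 < i <= t)%N then (-1) ^+ i * (matches_shift i.-1 h f)%:R else 0.
rewrite -(big_mkord predT (fun i => (-1) ^+ i * (matches h (face t i f))%:R : F)).
rewrite (telescope_sumr_eq (fun i => - a i)) // => [|i /andP[_ it]].
  by rewrite /a ltnn andbF ltnn subrr.
rewrite opprK addrC /a /=; move: it; rewrite ltnS => it.
case: (posnP i) => [->|i_gt0].
  by rewrite t_gt0 matches_face_0 // expr0 expr1 mulN1r mul1r sub0r opprK.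
have [e|it'] : i = t \/ (i < t)%N by lia.
  by subst t; rewrite leqnn ltnn matches_face_last //= subr0.
rewrite it it' matches_face_inner ?i_gt0 //= exprS mulN1r mulNr opprK.
by rewrite addrC mulrDr.
Qed.

Definition period_fun t h c : F^o :=
  \sum_(g in onto n t) (c g : F) * (matches h g)%:R.

Lemma period_fun_linear t h : linear (period_fun t h).
Proof.
move=> a c d; rewrite /period_fun scaler_sumr -big_split /=.
by apply: eq_bigr => g _; rewrite !ffunE mulrDl /GRing.scale /= mulrA.
Qed.

HB.instance Definition _ t h :=
  GRing.isLinear.Build F (placement_chain F n) F^o _ (period_fun t h)
    (period_fun_linear t h).

Definition period t h : 'Hom(placement_chain F n, F^o) := linfun (period_fun t h).

Lemma periodE t h c :
  period t h c = \sum_(g in onto n t) (c g : F) * (matches h g)%:R.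
Proof. by rewrite lfunE. Qed.

(** Exchanging the sums moves the boundary onto the cochain, where [sum_matches_face] says that it
    is a cocycle. *)
Lemma period_bd t h c : h \in sorted_words n 0 t -> period t h (bd F t (onto n t) c) = 0.
Proof.
move=> hS; have /sorted_wordsP[hW _ _] := hS; have t_gt0 := onto_gt0 hW.
rewrite periodE.
transitivity (\sum_(f in onto n t.+1)
    (c f : F) * \sum_(i < t.+1) (-1) ^+ i * (matches h (face t i f))%:R).
  under eq_bigr => g gW do rewrite bdE gW mulr_suml.
  under [RHS]eq_bigr => f _ do rewrite mulr_sumr.
  rewrite exchange_big [RHS]exchange_big /=; apply: eq_bigr => i _.
  under eq_bigr => g _ do rewrite -mulrA mulr_suml mulr_sumr.
  rewrite [RHS](partition_big (face t i) (mem (onto n t))) /= => [|f fW].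
    apply: eq_bigr => g gW; apply: eq_bigr => f /andP[_ /eqP ->].
    by rewrite mulrCA.
  by rewrite face_onto // -ltnS.
by rewrite big1 // => f fW; rewrite sum_matches_face // mulr0.
Qed.

End Cocycles.

Section Alternating.

Variables (F : numFieldType) (n : nat).
Implicit Types (f g h : placement n) (s t i j : nat) (u v w : 'I_n.+1).
Implicit Types (c : placement_chain F n) (r : {perm 'I_n.+1}).

Definition relabel r f : placement n := [ffun v => r (f v)].

Definition inner s : {set 'I_n.+1} := [set j : 'I_n.+1 | (0 < j < s)%N].

Lemma relabelM r1 r2 f : relabel (r1 * r2) f = relabel r2 (relabel r1 f).
Proof. by apply/ffunP => v; rewrite !ffunE permM. Qed.

Lemma relabel_inj r : injective (relabel r).
Proof.
by move=> f g fg; apply/ffunP => v; have /ffunP/(_ v) := fg; rewrite !ffunE => /perm_inj.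
Qed.

Lemma inner_perm0 s r : perm_on (inner s) r -> r ord0 = ord0.
Proof. by move=> rI; rewrite (out_perm rI) // inE. Qed.

Lemma inner_perm_lt s r (j : 'I_n.+1) : perm_on (inner s) r -> (j < s)%N -> (r j < s)%N.
Proof.
move=> rI js; have [->|j0] := eqVneq j ord0; first by
  rewrite (inner_perm0 rI) (leq_ltn_trans _ js).
have : r j \in inner s by rewrite perm_closed // inE js lt0n (contra _ j0).
by rewrite inE => /andP[].
Qed.

Lemma relabel_onto s r f : perm_on (inner s) r -> f \in onto n s ->
  relabel r f \in onto n s.
Proof.
move=> rI fW; apply/ontoP; split=> [|v|j js].
- by rewrite ffunE (onto_0 fW) (inner_perm0 rI).
- by rewrite ffunE (inner_perm_lt rI) ?onto_lt.
have jn : (j < n.+1)%N by rewrite (leq_trans js) ?(onto_le fW).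
have := inner_perm_lt (perm_onV rI) (j := Ordinal jn) js.
case/(onto_ex fW) => v fv; exists v; rewrite ffunE.
by have /val_inj -> := fv; rewrite permKV.
Qed.

Lemma relabel_ontoE s r f : perm_on (inner s) r ->
  (relabel r f \in onto n s) = (f \in onto n s).
Proof.
move=> rI; apply/idP/idP => [|/relabel_onto]; last exact.
move/(relabel_onto (perm_onV rI)); rewrite -relabelM mulgV.
suff -> : relabel 1 f = f by [].
by apply/ffunP => v; rewrite ffunE perm1.
Qed.

Definition alternating s c : Prop :=
  forall r f, perm_on (inner s) r -> c (relabel r f) = (-1) ^+ r * (c f : F).

Definition swap i : {perm 'I_n.+1} := tperm (inord i) (inord i.+1).

Lemma swapE i (j : 'I_n.+1) : (i < n)%N ->
  swap i j = (if j == i :> nat then i.+1 else if j == i.+1 :> nat then i else j)%N :> nat.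
Proof.
move=> i_n; rewrite /swap; case: tpermP => [->|->|/eqP ji /eqP ji1].
- by rewrite !inordK ?eqxx //; lia.
- by rewrite !inordK ?eqxx //; [case: eqP; lia|lia].
by move: ji ji1; rewrite -!val_eqE /= !inordK; [do !case: eqP|lia..].
Qed.

Lemma swap_on t i : (0 < i)%N -> (i < t)%N -> (t <= n)%N -> perm_on (inner t.+1) (swap i).
Proof.
move=> i_gt0 it tn; apply/subsetP => j; rewrite !inE; apply: contraNT => jt.
by apply/eqP/val_inj; rewrite /= swapE; [do !case: eqP; lia|lia].
Qed.

Lemma face_swap t i f : f \in onto n t.+1 -> (0 < i)%N -> (i < t)%N ->
  face t i (relabel (swap i) f) = face t i f.
Proof.
move=> fW i_gt0 it; have tn := onto_le fW.
apply/ffunP => v; apply/val_inj.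
rewrite /= !face_inner ?relabel_onto ?swap_on // ffunE swapE; last lia.
by do !case: eqP; lia.
Qed.

(* The cycle (1 t t-1 ... 2) *)
Definition shift t : {perm 'I_n.+1} := lift_perm (inord 1) (inord t) 1.

Lemma shiftE t (j : 'I_n.+1) : (0 < t)%N -> (t <= n)%N ->
  shift t j = (if j == 0 :> nat then 0 else if j == 1 :> nat then t
               else if j <= t then j.-1 else j)%N :> nat.
Proof.
move=> t_gt0 tn; rewrite /shift; case: (unliftP (inord 1) j) => [k ->|->].
  rewrite lift_perm_lift perm1 /= /bump !inordK; [|lia..].
  by have := ltn_ord k; do !case: ifP; do !case: eqP; lia.
by rewrite lift_perm_id !inordK //; lia.
Qed.

Lemma shift_on t : (0 < t)%N -> (t <= n)%N -> perm_on (inner t.+1) (shift t).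
Proof.
move=> t_gt0 tn; apply/subsetP => j; rewrite !inE; apply: contraNT => jt.
apply/eqP/val_inj; rewrite /= shiftE //.
by do !case: ifP; do !case: eqP; lia.
Qed.

Lemma odd_shift t : (0 < t)%N -> (t <= n)%N -> odd_perm (shift t) = ~~ odd t.
Proof. by move=> t_gt0 tn; rewrite odd_lift_perm odd_perm1 addbF !inordK //; lia. Qed.

Lemma face_shift t f : f \in onto n t.+1 -> (0 < t)%N ->
  face t t (relabel (shift t) f) = face t 0 f.
Proof.
move=> fW t_gt0; have tn := onto_le fW.
apply/ffunP => v; apply/val_inj.
rewrite /= face_last ?face_inner ?relabel_onto ?shift_on // ffunE shiftE //.
by have := onto_lt v fW; do !case: ifP; do !case: eqP; lia.
Qed.

Lemma sum_face_relabel t i j r g c : alternating t.+1 c -> perm_on (inner t.+1) r ->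
  (forall f, f \in onto n t.+1 -> face t j (relabel r f) = face t i f) ->
  \sum_(f in onto n t.+1 | face t j f == g) (c f : F) =
  (-1) ^+ r * \sum_(f in onto n t.+1 | face t i f == g) (c f : F).
Proof.
move=> calt rI rf; rewrite (reindex_inj (@relabel_inj r)) mulr_sumr /=.
apply: eq_big => [f|f _]; last exact: calt.
by rewrite relabel_ontoE //; apply: andb_id2l => fW; rewrite rf.
Qed.

(** An inner face does not see a swap of the two letters it merges, so its terms cancel. The two
    outer faces differ by the cyclic shift of the letters 1 to [t], whose sign (-1)^(t-1) meets the
    relative sign (-1)^t. *)
Lemma alternating_cycle t c : alternating t.+1 c -> bd F t (onto n t) c = 0.
Proof.
move=> calt; apply/ffunP => g; rewrite bdE ffunE; case: ifP => // gW.
have t_gt0 := onto_gt0 gW.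
case: (set_0Vmem (onto n t.+1)) => [W0|[f0 f0W]].
  by rewrite big1 // => i _; rewrite big_pred0 ?mulr0 // => f; rewrite W0 inE.
have tn : (t <= n)%N by have := onto_le f0W.
case: t gW t_gt0 tn f0W calt => // t gW t_gt0 tn f0W calt.
rewrite big_ord_recl big_ord_recr /= [X in _ + (X + _)]big1 ?add0r => [|[i it] _].
  rewrite /bump leq0n add1n (sum_face_relabel g calt (shift_on t_gt0 tn)
    (fun f fW => face_shift fW t_gt0)).
  rewrite odd_shift //= expr0 mul1r mulrA -signr_odd -signr_addb /=.
  by case: odd; rewrite mulN1r subrr.
rewrite /= /bump leq0n add1n; set S := (X in _ * X).
have it' : (i.+1 < t.+1)%N by [].
have odd_swap : odd_perm (swap i.+1) by rewrite odd_tperm -val_eqE /= !inordK; lia.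
have := sum_face_relabel g calt (swap_on (ltn0Sn i) it' tn)
  (fun f fW => face_swap fW (ltn0Sn i) it').
(* The sum over an inner face equals its own opposite, and 2 is invertible. *)
rewrite -/S odd_swap expr1 mulN1r => /eqP; rewrite -addr_eq0 -mulr2n mulrn_eq0 /=.
by move=> /eqP ->; rewrite mulr0.
Qed.

(** The fundamental class of the subtorus on which vertices sharing a letter of [f] coincide. *)
Definition alternation s f : placement_chain F n :=
  [ffun g => \sum_(r | perm_on (inner s) r) (-1) ^+ r * (relabel r f == g)%:R].

Lemma alternation_alternating s f : alternating s (alternation s f).
Proof.
move=> r g rI; rewrite !ffunE mulr_sumr (reindex_inj (mulIg r)) /=.
apply: eq_big => [q|q qI].
  apply/idP/idP => [|qI]; last exact: perm_onM.
  by move=> qrI; rewrite -[q](mulgK r) perm_onM // perm_onV.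
by rewrite odd_permM signr_addb mulrA [_ ^+ r * _]mulrC relabelM (inj_eq (@relabel_inj r)).
Qed.

Lemma alternation_supported s f (P : {set placement n}) :
  (forall r, perm_on (inner s) r -> relabel r f \in P) ->
  alternation s f \in supported F P.
Proof.
move=> fP; apply/supportedP => g gP; rewrite ffunE big1 // => r rI.
by case: eqP gP => [<-|_ _]; rewrite ?mulr0 // fP.
Qed.

Lemma relabel_id s r f : perm_on (inner s) r -> f \in onto n s ->
  (forall v, (0 < f v)%N -> r (f v) = f v) -> r = 1%g.
Proof.
move=> rI fW rf; apply/permP => j; rewrite perm1.
have [|/(out_perm rI)//] := boolP (j \in inner s).
rewrite inE => /andP[j0 js]; have [v fv] := onto_ex fW js.
by rewrite -(val_inj fv) rf // fv.
Qed.

(** A match puts [above 0 g] inside [above 0 f]; the sizes agree, so [g = f], and then [r] fixes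
    every position in use. *)
Lemma sorted_words_relabel_0 s r f g : perm_on (inner s) r ->
  f \in sorted_words n 0 s -> g \in sorted_words n 0 s ->
  matches g (relabel r f) = (g == f) && (r == 1%g).
Proof.
move=> rI fS gS; have /sorted_wordsP[fW _ _] := fS; have s_gt0 := onto_gt0 fW.
apply/matchesP/andP => [gf|[/eqP -> /eqP ->] v _]; last by rewrite ffunE perm1.
have /eqP gE : g == f.
  apply/eqP/(above_inj _ gS fS) => //; apply/eqP; rewrite eqEcard.
  rewrite (card_above fS) // (card_above gS) // leqnn andbT.
  apply/subsetP => v; rewrite !inE => gv; rewrite lt0n; apply/negP => /eqP fv.
  have := gf v gv; rewrite ffunE (_ : f v = ord0); last exact/val_inj.
  by rewrite (inner_perm0 rI) => g0; rewrite -g0 in gv.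
subst g; split=> //; apply/eqP/(relabel_id rI fW) => v fv.
by rewrite -{2}(gf v fv) ffunE.
Qed.

Lemma period_alternation s f g :
  f \in sorted_words n 0 s -> g \in sorted_words n 0 s ->
  period F s g (alternation s f) = (g == f)%:R.
Proof.
move=> fS gS; have /sorted_wordsP[fW _ _] := fS; rewrite periodE.
transitivity (\sum_(r | perm_on (inner s) r) (-1) ^+ r * (matches g (relabel r f))%:R : F).
  under eq_bigr => h _ do rewrite ffunE mulr_suml.
  rewrite exchange_big /=; apply: eq_bigr => r rI.
  rewrite (bigD1 (relabel r f)) ?relabel_onto //= eqxx mulr1 big1 ?addr0 // => h.
  by case/andP=> _ /negPf; rewrite eq_sym => ->; rewrite mulr0 mul0r.
rewrite (bigD1 1%g) ?perm_on1 //= big1 => [|r /andP[rI /negPf r1]].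
  by rewrite (sorted_words_relabel_0 (perm_on1 _) fS gS) eqxx andbT odd_perm1 mul1r addr0.
by rewrite (sorted_words_relabel_0 rI fS gS) r1 andbF mulr0.
Qed.

Definition cycles d : {vspace placement_chain F n} :=
  (supported F (onto n d.+1) :&: lker (bd F d (onto n d)))%VS.

Lemma alternation_cycle d f : f \in onto n d.+1 -> alternation d.+1 f \in cycles d.
Proof.
move=> fW; rewrite memv_cap memv_ker (alternating_cycle (@alternation_alternating _ f)).
rewrite eqxx andbT; apply: alternation_supported => r rI; exact: relabel_onto.
Qed.

Definition boundaries d : {vspace placement_chain F n} :=
  (bd F d.+1 (onto n d.+1) @: supported F (onto n d.+2))%VS.

Definition periods d := values (fun h : {h | h \in sorted_words n 0 d.+1} =>
  period F d.+1 (val h)).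

Lemma boundaries_sub d : (boundaries d <= cycles d)%VS.
Proof.
apply/subvP => _ /memv_imgP[c _ ->]; rewrite memv_cap bd_supported memv_ker /=.
by rewrite bd_bd.
Qed.

Lemma boundaries_periods d : (boundaries d <= cycles d :&: lker (periods d))%VS.
Proof.
rewrite subv_cap boundaries_sub; apply/subvP => _ /memv_imgP[c _ ->].
rewrite memv_ker; apply/eqP/ffunP => -[h hS]; rewrite valuesE ffunE /=.
by rewrite period_bd.
Qed.

(* The alternations of the sorted words are cycles dual to the periods. *)
Lemma dim_cap_periods d (U : {vspace placement_chain F n}) :
  (forall f, f \in sorted_words n 0 d.+1 -> alternation d.+1 f \in U) ->
  (\dim (U :&: lker (periods d)) + #|sorted_words n 0 d.+1|)%N = \dim U.
Proof.
move=> altU; rewrite -[#|_|]card_sig.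
pose H : finType := {h | h \in sorted_words n 0 d.+1}.
apply: (@dim_cap_values F _ H _ _ (fun h : H => alternation d.+1 (val h))).
  by case=> h hS; apply: altU.
by move=> [f fS] [g gS]; rewrite period_alternation.
Qed.

End Alternating.

(** * The matching, and the homology of the torus *)

Section Matching.

Variable n : nat.
Implicit Types (f g h : placement n) (s t i j : nat) (u v w m : 'I_n.+1).

(** It fails at the last letter, so even a sorted word with several letters has a first failure
    there. *)
Definition ascending f u : bool :=
  [forall v, (f v == f u) ==> (v == u)]
  && [exists w, (f w == (f u).+1 :> nat) && (u < w)%N].

Lemma ascendingP f u :
  reflect ((forall v, f v = f u :> nat -> v = u)
           /\ exists w, f w = (f u).+1 :> nat /\ (u < w)%N)
          (ascending f u).
Proof.
apply: (iffP andP) => -[h1 h2]; split.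
- by move=> v /val_inj /eqP fv; apply/eqP/(implyP (forallP h1 v)).
- by have /existsP[w /andP[/eqP fw uw]] := h2; exists w.
- by apply/forallP => v; apply/implyP => /eqP fv; apply/eqP/h1; rewrite fv.
by have [w [fw uw]] := h2; apply/existsP; exists w; rewrite fw eqxx.
Qed.

Lemma sorted_above_ascending p s f : f \in onto n s ->
  (forall u v, (p < f u)%N -> f v = f u :> nat -> v = u) ->
  (forall u, (p < f u)%N -> ((f u).+1 < s)%N -> ascending f u) ->
  sorted_above p f.
Proof.
move=> fW single asc; apply/sorted_aboveP.
suff H k a b : (f b - f a <= k)%N -> (p < f a)%N -> (f a <= f b)%N -> (a <= b)%N.
  by move=> a b; apply: (H (f b - f a)%N).
elim: k a => [|k IHk] a abk pa ab; have bs := onto_lt b fW.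
  by rewrite (single a b pa) //; lia.
have [fab|fab] : (f b = f a :> nat \/ f a < f b)%N by lia.
  by apply: IHk => //; lia.
have /ascendingP[_ [w [fw aw]]] := asc a pa ltac:(lia).
by apply: leq_trans (ltnW aw) _; apply: IHk; lia.
Qed.

(* In the first letter (other than the one containing the vertex 0) at which the
   word stops being an ascending run of single vertices, m is the greatest of at
   least two vertices.  The word is then matched with the word where m is split
   off to the left. *)
Definition splittable g m : bool :=
  [&& (0 < g m)%N, [forall v, (g v == g m) ==> (v <= m)%N],
      [exists v, (v != m) && (g v == g m)]
    & [forall u, (0 < g u < g m)%N ==> ascending g u]].

Lemma splittableP g m :
  reflect [/\ (0 < g m)%N, forall v, g v = g m :> nat -> (v <= m)%N,
              exists v, v <> m /\ g v = g m :> nat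
            & forall u, (0 < g u)%N -> (g u < g m)%N -> ascending g u]
          (splittable g m).
Proof.
apply: (iffP and4P) => -[h1 h2 h3 h4]; split=> //.
- by move=> v /val_inj /eqP gv; apply: (implyP (forallP h2 v)).
- by have /existsP[v /andP[/eqP vm /eqP gv]] := h3; exists v; rewrite gv.
- by move=> u u0 um; apply: (implyP (forallP h4 u)); rewrite u0.
- by apply/forallP => v; apply/implyP => /eqP gv; apply: h2; rewrite gv.
- have [v [/eqP vm gv]] := h3; apply/existsP; exists v; rewrite vm /=.
  by apply/eqP/val_inj.
by apply/forallP => u; apply/implyP => /andP[]; apply: h4.
Qed.

Lemma splittable_uniq g m m' : splittable g m -> splittable g m' -> m = m'.
Proof.
case/splittableP=> m0 maxm [v [vm gv]] ascm.
case/splittableP=> m0' maxm' [v' [vm' gv']] ascm'.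
case: (ltngtP (g m) (g m')) => [lt|lt|e].
- by have /ascendingP[/(_ v gv)] := ascm' m m0 lt.
- by have /ascendingP[/(_ v' gv')] := ascm m' m0' lt.
by apply/val_inj/eqP; rewrite eqn_leq /= maxm' // maxm.
Qed.

(** Guarantees that a splittable word leaves room for one more letter. *)
Lemma onto_collision s f u v : f \in onto n s -> u <> v -> f u = f v :> nat -> (s <= n)%N.
Proof.
move=> fW uv fuv; have s_gt0 := onto_gt0 fW; have sn := onto_le fW.
have /proper_card : [set j : 'I_n.+1 | (0 < j <= s.-1)%N] \proper f @: [set~ u].
  have img j : (j < s)%N -> exists2 w, w \in [set~ u] & f w = j :> nat.
    move=> /(onto_ex fW)[w fw]; have [wu|wu] := eqVneq w u.
      by exists v; rewrite ?inE -?fuv -?wu //; apply/eqP => vu; case: uv; rewrite vu.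
    by exists w; rewrite ?inE.
  apply/properP; split.
    apply/subsetP => j; rewrite inE => js; have [|w wu fw] := img j; first lia.
    by apply/imsetP; exists w => //; apply/val_inj.
  exists ord0; last by rewrite inE.
  by have [w wu fw] := img 0%N s_gt0; apply/imsetP; exists w => //; apply/val_inj.
have := leq_imset_card f [set~ u]; rewrite cardsC1 card_ord card_interval; last lia.
by move=> le lt; have := leq_trans lt le; lia.
Qed.

Definition split m g : placement n :=
  [ffun v => inord (g v + ((g m <= g v)%N && (v != m)))].

Section Split.

Variables (t : nat) (g : placement n) (m : 'I_n.+1).
Hypotheses (gW : g \in onto n t) (gm : splittable g m).

Lemma splittable_le : (t <= n)%N.
Proof.
by case/splittableP: gm => _ _ [v [vm gv]] _; apply: (onto_collision gW vm gv).
Qed.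

Lemma splitE v :
  split m g v = (g v + ((g m <= g v)%N && (v != m)))%N :> nat.
Proof.
rewrite ffunE inordK //; have := onto_lt v gW; have := splittable_le.
by case: (_ && _); lia.
Qed.

Lemma split_onto : split m g \in onto n t.+1.
Proof.
have /splittableP[m0 maxm [v [/eqP vm gv]] _] := gm.
have mt := onto_lt m gW; apply/ontoP; split=> [|u|j jt].
- by apply/val_inj; rewrite /= splitE (onto_0 gW) /= leqNgt m0.
- by rewrite splitE; have := onto_lt u gW; case: (_ && _); lia.
case: (ltngtP j (g m)) => [jm|mj|->].
- have [|u gu] := onto_ex (j := j) gW; first lia.
  by exists u; rewrite splitE gu leqNgt jm addn0.
- have [jm|jm] := leqP j (g m).+1.
    by exists v; rewrite splitE vm gv leqnn /=; lia.
  have [|u gu] := onto_ex (j := j.-1) gW; first lia.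
  exists u; rewrite splitE gu; have [um|um] := eqVneq u m; last by case: leqP; lia.
  by rewrite um in gu; lia.
by exists m; rewrite splitE eqxx andbF addn0.
Qed.

Lemma face_split : face t (g m) (split m g) = g.
Proof.
have mt := onto_lt m gW; apply/ffunP => v; apply/val_inj => /=.
rewrite face_inner ?split_onto // splitE.
by have [->|vm] := eqVneq v m; rewrite ?andbF ?andbT; [lia|case: leqP; lia].
Qed.

(** In a split word the first failure of ascent is a descent from the single vertex [m], whereas in
    a splittable word it is a letter with several vertices. *)
Lemma split_descends u : 
  [/\ ((0 < split m g u)%N -> (split m g u < g m)%N -> ascending (split m g) u),
      (split m g u = g m :> nat -> u = m)
    & (split m g u = (g m).+1 :> nat -> (u < m)%N)].
Proof.
have /splittableP[m0 maxm [v [vm gv]] ascm] := gm; split.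
- rewrite splitE => u0 um; have gu : split m g u = g u :> nat.
    by rewrite splitE; case: (leqP (g m) (g u)) um => //=; [case: eqP; lia|rewrite addn0].
  have gum : (g u < g m)%N by rewrite -gu splitE.
  have /ascendingP[uu [w [gw uw]]] := ascm u ltac:(by rewrite -gu splitE) gum.
  apply/ascendingP; rewrite gu; split=> [w'|].
    move=> w'u; apply: uu; move: w'u; rewrite splitE.
    by have [->|_] := eqVneq w' m; rewrite ?andbF ?andbT; [lia|case: leqP; lia].
  have [wm|wm] := ltnP (g w) (g m).
    by exists w; rewrite splitE leqNgt wm addn0.
  have wm' : (w <= m)%N by apply: maxm; lia.
  by exists m; rewrite splitE eqxx andbF; split; lia.
- by rewrite splitE; have [//|um] := eqVneq u m; rewrite andbT; case: leqP; lia.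
rewrite splitE; have [->|um] := eqVneq u m; first by rewrite andbF; lia.
rewrite andbT => gu; have : (u <= m)%N by apply: maxm; move: gu; case: leqP; lia.
by rewrite leq_eqVlt => /orP[/eqP/val_inj e|//]; rewrite e eqxx in um.
Qed.

End Split.

(** Only the face [i] brings the letters [i] and [i + 1] together at position [i]. Diagonal
    coefficients of the matching are therefore single signs. *)
Lemma face_eq_inner t i j f : f \in onto n t.+1 -> (0 < i < t)%N -> (j <= t)%N ->
  face t j f = face t i f -> j = i.
Proof.
move=> fW /andP[i0 it] jt e.
have [|u fu] := onto_ex (j := i) fW; first lia.
have [|v fv] := onto_ex (j := i.+1) fW; first lia.
have := congr1 (fun g : placement n => g u : nat) e.
have := congr1 (fun g : placement n => g v : nat) e.
rewrite /= !(face_inner _ fW it) fu fv; have [jt'|->] : (j < t)%N \/ j = t by lia.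
  by rewrite !(face_inner _ fW jt') fu fv; lia.
by rewrite !face_last ?fu ?fv //; [do 2!case: eqP; lia|lia..].
Qed.

(* Enlarging the letter of the vertex 0 comes first; then positions are compared
   lexicographically, greater vertices first. *)
Definition weight f : nat :=
  ((\sum_(v < n.+1) (0 < f v)) * (\sum_(v < n.+1) 2 ^ v * n.+1)
   + \sum_(v < n.+1) 2 ^ v * f v)%N.

(** The factor of the first sum in [weight] strictly bounds the second sum, so the number of
    vertices outside the first letter decides. *)
Lemma weight_lt_nonzero f g :
  (forall v, (0 < f v)%N -> (0 < g v)%N) -> (exists2 v, f v = ord0 & (0 < g v)%N) ->
  (weight f < weight g)%N.
Proof.
move=> fg [u fu gu]; rewrite /weight.
set B := (\sum_(v < n.+1) 2 ^ v * n.+1)%N.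
have fB : (\sum_(v < n.+1) 2 ^ v * f v < B)%N.
  rewrite /B [X in (X < _)%N](bigD1 ord0) //= [X in (_ < X)%N](bigD1 ord0) //=.
  rewrite -addSn leq_add //; first by rewrite expn0 !mul1n ltn_ord.
  by apply: leq_sum => v _; rewrite leq_mul2l ltnW ?orbT // ltn_ord.
have : (\sum_(v < n.+1) (0 < f v) < \sum_(v < n.+1) (0 < g v))%N.
  rewrite [X in (X < _)%N](bigD1 u) //= [X in (_ < X)%N](bigD1 u) //= fu gu /=.
  rewrite add0n add1n ltnS leq_sum // => v _.
  by case: (posnP (f v)) => [//|/fg ->].
by move=> lt; apply: leq_trans (_ : ((\sum_(v < n.+1) (0 < f v)).+1 * B <= _)%N); [|nia];
  rewrite mulSn addnC; lia.
Qed.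

Lemma sum_pow2_lt (P : pred 'I_n.+1) m : (forall v, P v -> (v < m)%N) ->
  (\sum_(v | P v) 2 ^ v < 2 ^ m)%N.
Proof.
move=> Pm; apply: (@leq_ltn_trans (\sum_(v < n.+1 | (v < m)%N) 2 ^ v)%N).
  rewrite big_mkcond [X in (_ <= X)%N]big_mkcond leq_sum // => v _.
  by case: ifP => // /Pm ->.
rewrite -(big_ord_widen _ (fun i : nat => 2 ^ i)%N); last exact: ltnW.
have := predn_exp 2 m; rewrite mul1n => <-.
by rewrite prednK // expn_gt0.
Qed.

(* Up to the words enlarging the letter of the vertex 0, if a face of split m' g'
   is g and g' <> g, then split m' g' is obtained from split m g by moving m one
   place to the right and some smaller vertices one place to the left. *)
Lemma weight_split_lt t g g' m m' j :
  g \in onto n t -> g' \in onto n t -> splittable g m -> splittable g' m' ->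
  (j <= t)%N -> face t j (split m' g') = g ->
  g' = g \/ (weight (split m g) < weight (split m' g'))%N.
Proof.
move=> gW g'W gm gm' jt fg; have f'W := split_onto g'W gm'.
have t_gt0 := onto_gt0 gW.
(* An outer face enlarges the letter of the vertex 0, and splitting at [m] does not change that
   letter. *)
have [j0|[j0 {}jt]] : (j = 0 \/ j = t) \/ ((0 < j)%N /\ (j < t)%N) by lia.
  right; apply: weight_lt_nonzero => [v|].
    have gv : (0 < split m g v)%N -> (0 < g v)%N.
      have /splittableP[m0 _ _ _] := gm.
      by rewrite (splitE gW gm); case: leqP => /=; lia.
    move=> /gv; rewrite -fg; case: j0 => ->; first by rewrite face_inner //; lia.
    by rewrite face_last //; case: eqP.
  have zero v : g v = 0 :> nat -> split m g v = ord0.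
    move=> gv; apply/val_inj; rewrite /= (splitE gW gm) gv.
    by have /splittableP[m0 _ _ _] := gm; rewrite leqNgt m0.
  case: j0 => j0; subst j.
    have [|v fv] := onto_ex (j := 1) f'W; first lia.
    by exists v; rewrite ?fv //; apply: zero; rewrite -fg face_inner // fv.
  have [|v fv] := onto_ex (j := t) f'W; first lia.
  by exists v; rewrite ?fv //; apply: zero; rewrite -fg face_last // fv eqxx.
have gE v : g v = (split m' g' v - (j < split m' g' v)%N)%N :> nat.
  by rewrite -fg face_inner.
have desc := split_descends g'W gm'.
have fm' : split m' g' m' = g' m' :> nat by rewrite (splitE g'W gm') eqxx andbF addn0.
have [ji|ji] := eqVneq j (g' m'); first by left; rewrite -fg ji face_split.
right; have /splittableP[m0 maxm [v [vm gv]] ascm] := gm.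
have /splittableP[m0' _ _ _] := gm'.
have [|u0 fu0] := onto_ex (j := j) f'W; first lia.
have [|u1 fu1] := onto_ex (j := j.+1) f'W; first lia.
(* The merged letter holds [u0] and [u1], so it cannot precede that of [m]. If the letter of [m]
   came before [j], it would be a letter with several vertices of [split m' g'] too early for
   [split_descends], or lie after the descent at [m'], which [g] would inherit against its
   ascent. *)
have gmj : g m = j :> nat.
  case: (ltngtP (g m) j) => // lt; last first.
    have /ascendingP[/(_ u1)] := ascm u0 ltac:(rewrite gE; lia) ltac:(rewrite gE; lia).
    by rewrite !gE fu0 fu1 => u10; move: fu0; rewrite -u10 ?fu1; lia.
  have fm : split m' g' m = g m :> nat by have := gE m; lia.
  have fv : split m' g' v = g m :> nat by have := gE v; lia.
  case: (ltngtP (g m) (g' m')) => [lt'|lt'|e].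
  - have [asc _ _] := desc m; have /ascendingP[/(_ v)] := asc ltac:(lia) ltac:(lia).
    by move=> vm'; case: vm; apply: vm'; lia.
  - have gm'' : g m' = g' m' :> nat by rewrite gE; lia.
    have /ascendingP[_ [w [gw mw]]] := ascm m' ltac:(lia) ltac:(lia).
    have fw : split m' g' w = (g' m').+1 :> nat by have := gE w; lia.
    by have [_ _ /(_ fw)] := desc w; lia.
  have [_ /(_ ltac:(lia)) e1 _] := desc m; have [_ /(_ ltac:(lia)) e2 _] := desc v.
  by case: vm; rewrite e1 e2.
(* Were [m] in the left one of the merged letters, either the ascent from [m] would lead to a
   greater vertex in the same letter of [g], or the descent at [m'] would contradict the ascent of
   [g]. *)
have fmj : split m' g' m = j.+1 :> nat.
  have : split m' g' m <> j :> nat; last by have := gE m; lia.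
  move=> fm; case: (ltngtP j (g' m')) => [lt|lt|e]; last by rewrite e eqxx in ji.
    have [asc _ _] := desc m.
    have /ascendingP[_ [w [fw mw]]] := asc ltac:(lia) ltac:(lia).
    by have := maxm w; rewrite gE fw fm gmj; lia.
  have gm'' : g m' = g' m' :> nat by rewrite gE; lia.
  have /ascendingP[_ [w [gw mw]]] := ascm m' ltac:(lia) ltac:(lia).
  have [lt'|e] : ((g' m').+1 < j \/ (g' m').+1 = j)%N by lia.
    have fw : split m' g' w = (g' m').+1 :> nat by have := gE w; lia.
    by have [_ _ /(_ fw)] := desc w; lia.
  have wm : (w <= m)%N by apply: maxm; lia.
  by have [_ _ /(_ ltac:(lia))] := desc m; lia.
have fE u : (split m g u + (u == m) = split m' g' u + (split m' g' u == j :> nat))%N.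
  rewrite (splitE gW gm) gmj gE; have [->|um] := eqVneq u m.
    by rewrite fmj andbF; case: eqP; lia.
  by rewrite andbT; case: leqP; case: ltnP; case: eqP; lia.
have nz u : (0 < split m g u)%N = (0 < split m' g' u)%N.
  by have := fE u; have [->|um] := eqVneq u m; case: eqP; lia.
rewrite /weight; under eq_bigr => u _ do rewrite nz.
rewrite ltn_add2l -(ltn_add2r (\sum_(u < n.+1) 2 ^ u * (u == m))).
rewrite -big_split /=; under eq_bigr => u _ do rewrite -mulnDr fE mulnDr.
have -> : (\sum_(u < n.+1) 2 ^ u * (u == m) = 2 ^ m)%N.
  rewrite (bigD1 m) //= big1 => [|u /negPf ->]; last by rewrite muln0.
  by rewrite eqxx muln1 addn0.
rewrite big_split /= ltn_add2l (eq_bigr (fun u : 'I_n.+1 =>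
    if split m' g' u == j :> nat then 2 ^ u else 0)%N); last first.
  by move=> u _; case: eqP; rewrite ?muln1 ?muln0.
(* The vertices moved to the left share the letter of [m] in [g], hence lie below [m]: their powers
   of 2 add up to less than [2 ^ m]. *)
rewrite -big_mkcond /=; apply: sum_pow2_lt => u /eqP fu.
have um : u != m by apply: contra_eq_neq fmj => <-; rewrite fu; lia.
have : (u <= m)%N by apply: maxm; rewrite gE fu; lia.
by rewrite leq_eqVlt => /orP[/eqP/val_inj e|//]; rewrite e eqxx in um.
Qed.

Definition splittables s : {set placement n} :=
  [set g in onto n s | [exists m, splittable g m]].

Definition split_top g : placement n :=
  if [pick m | splittable g m] is Some m then split m g else g.

Lemma split_topE g m : splittable g m -> split_top g = split m g.
Proof.
move=> gm; rewrite /split_top; case: pickP => [m' gm'|/(_ m)]; last by rewrite gm.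
by rewrite (splittable_uniq gm gm').
Qed.

Lemma splittablesP s g :
  reflect (g \in onto n s /\ exists m, splittable g m) (g \in splittables s).
Proof.
by rewrite [g \in splittables _]in_set; apply: (iffP andP) => -[gW /existsP].
Qed.

(** Consider the first letter beyond position 0 where ascent fails. Several vertices there make the
    word splittable; a descent from a single vertex makes it the split of the word with these two
    letters merged; a single last letter means that the word is sorted. *)
Lemma onto_matching s f : f \in onto n s ->
  [\/ f \in sorted_words n 0 s, f \in splittables s
    | exists2 g, g \in splittables s.-1 & f = split_top g].
Proof.
move=> fW; have s_gt0 := onto_gt0 fW.
have [srt|nsrt] := boolP (sorted_above 0 f).
  by constructor 1; apply/sorted_wordsP; split.
have [a a0] : exists a, (0 < f a)%N.
  apply/existsP; apply: contraNT nsrt => /existsPn f0.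
  by apply/sorted_aboveP => u v u0; have := f0 u; rewrite u0.
have [|u1 fu1] := onto_ex (j := s.-1) fW; first lia.
have desc1 : (0 < f u1)%N && ~~ ascending f u1.
  have := onto_lt a fW => fa; apply/andP; split; first lia.
  by apply/ascendingP => -[_ [w [fw _]]]; have := onto_lt w fW; lia.
case: (arg_minnP (P := [pred u | (0 < f u)%N && ~~ ascending f u]) (fun u => f u) desc1).
move=> u /andP[u0 nasc] umin {a a0 desc1}.
have asc v : (0 < f v)%N -> (f v < f u)%N -> ascending f v.
  by move=> v0 vu; apply: contraLR vu => vn; rewrite -leqNgt; apply: umin; rewrite /= v0.
have ut := onto_lt u fW.
have [/existsP[v /andP[vu /eqP fvu]]|single] := boolP [exists v, (v != u) && (f v == f u)].
  constructor 2; apply/splittablesP; split=> //.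
  case: (arg_maxnP (P := [pred w | f w == f u]) val (eqxx (f u))) => m /= /eqP fm mmax.
  exists m; apply/splittableP; rewrite fm; split=> //.
    by move=> w /val_inj/eqP/mmax.
  have [mu|mu] := eqVneq u m; first by exists v; rewrite -mu fvu; split=> //; apply/eqP.
  by exists u; split=> //; apply/eqP.
have {}single v : f v = f u :> nat -> v = u.
  move=> /val_inj fvu; apply/eqP; apply: contraNT single => vu.
  by apply/existsP; exists v; rewrite vu fvu eqxx.
have next v : f v = (f u).+1 :> nat -> (v < u)%N.
  move=> fv; rewrite ltnNge leq_eqVlt; apply/negP => /orP[/eqP/val_inj e|uv].
    by move: fv; rewrite e; lia.
  by move/ascendingP: nasc; apply; split=> //; exists v.
have [us|us] := ltnP (f u).+1 s; last first.
  case/negP: nsrt; apply: (sorted_above_ascending fW) => [v w v0 fvw|v v0 vs].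
    have [vu|vu] : (f v < f u \/ f v = f u :> nat)%N by have := onto_lt v fW; lia.
      by have /ascendingP[/(_ w fvw)] := asc v v0 vu.
    by rewrite (single v) // (single w) //; lia.
  by apply: asc => //; lia.
constructor 3; have sE : s = s.-1.+1 by lia.
rewrite sE in fW; have us' : (f u < s.-1)%N by lia.
have gE v := face_inner v fW us'.
set g := face s.-1 (f u) f in gE.
have gW : g \in onto n s.-1 by apply: face_onto => //; lia.
have gu : g u = f u :> nat by rewrite gE; lia.
have gm : splittable g u.
  apply/splittableP; rewrite gu; split=> //.
  - move=> v; rewrite gE => gv.
    have [/single ->//|/next/ltnW//] : f v = f u :> nat \/ f v = (f u).+1 :> nat by lia.
  - have [|v fv] := onto_ex (j := (f u).+1) fW; first lia.
    by exists v; rewrite gE fv; split; [move=> vu; rewrite vu in fv|]; lia.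
  move=> v; rewrite !gE => v0 vu; have fv : g v = f v :> nat by rewrite gE; lia.
  have /ascendingP[vv [w [fw vw]]] := asc v ltac:(lia) ltac:(lia).
  apply/ascendingP; rewrite fv; split=> [w'|].
    by rewrite gE => fw'; apply: vv; lia.
  by exists w; rewrite gE fw; split=> //; lia.
exists g; first by apply/splittablesP; split=> //; exists u.
rewrite (split_topE gm); apply/ffunP => v; apply/val_inj; rewrite /= (splitE gW gm) gu gE.
have [->|vu] := eqVneq v u; first by rewrite andbF; lia.
have fv : f v <> f u :> nat by move=> /single e; rewrite e eqxx in vu.
by rewrite andbT; case: leqP; case: ltnP; lia.
Qed.

Lemma card_onto_le s :
  (#|onto n s| <= #|sorted_words n 0 s| + #|splittables s| + #|splittables s.-1|)%N.
Proof.
have sub : onto n s \subset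
    sorted_words n 0 s :|: splittables s :|: split_top @: splittables s.-1.
  apply/subsetP => f /onto_matching[fS|fD|[g gD ->]].
  - by rewrite in_setU in_setU fS.
  - by rewrite in_setU in_setU fD orbT.
  by rewrite in_setU imset_f ?orbT.
apply: leq_trans (subset_leq_card sub) _.
rewrite -addnA; apply: leq_trans (leq_card_setU _ _).1 _.
rewrite addnA leq_add ?leq_imset_card //; exact: (leq_card_setU _ _).1.
Qed.

End Matching.

(** * Ranks of the boundaries of the torus *)

Section Rank.

Variables (F : numFieldType) (n : nat).

Lemma bd_point t f g : f \in onto n t.+1 -> g \in onto n t ->
  bd F t (onto n t) (point F f) g = \sum_(j < t.+1) (-1) ^+ j * (face t j f == g)%:R.
Proof.
move=> fW gW; rewrite bdE gW; apply: eq_bigr => j _; congr (_ * _).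
case: eqP => [fg|fg].
  rewrite (bigD1 f) ?fW /=; last exact/eqP.
  rewrite ffunE eqxx big1 ?addr0 // => h /andP[_ /negPf hf].
  by rewrite ffunE eq_sym hf.
rewrite big1 // => h /andP[_ /eqP hg]; rewrite ffunE.
by case: eqP => // fh; case: fg; rewrite fh.
Qed.

(** The boundaries of the split words are triangular for [weight], with a sign on the diagonal,
    hence independent. *)
Lemma card_splittables_le d :
  (#|splittables n d.+1| <= \dim (boundaries F n d))%N.
Proof.
rewrite -card_sig; pose D : finType := {g | g \in splittables n d.+1}.
have split_onto' (q : D) : split_top (val q) \in onto n d.+2.
  by case: q => g /= /splittablesP[gW [m gm]]; rewrite (split_topE gm) split_onto.
apply: (@card_le_dim_triangular _ _ D _ (fun q : D => eval F (val q))
  (fun q : D => bd F d.+1 (onto n d.+1) (point F (split_top (val q))))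
  (fun q : D => weight (split_top (val q)))).
- move=> q; apply: memv_img; apply/supportedP => f; rewrite ffunE.
  by case: eqP => // <-; rewrite split_onto'.
- move=> q; rewrite evalE.
  have := split_onto' q; case: q => g /= /[dup] gD /splittablesP[gW [m gm]].
  rewrite (split_topE gm) => fW; rewrite bd_point //.
  have mt := onto_lt m gW; have /splittableP[m0 _ _ _] := gm.
  have mt' : (g m < d.+2)%N by apply: ltnW.
  rewrite (bigD1 (Ordinal mt')) //= face_split // eqxx mulr1 big1 ?addr0.
    by rewrite signr_eq0.
  move=> j jm; case: eqP; rewrite ?mulr0 // => e; case/eqP: jm; apply/val_inj => /=.
  apply: (face_eq_inner fW); [by rewrite m0|by rewrite -ltnS|].
  by rewrite face_split.
move=> [g gD] [g' gD'] /=; rewrite evalE.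
have /splittablesP[gW [m gm]] := gD; have /splittablesP[gW' [m' gm']] := gD'.
have fW' := split_onto' (exist _ g' gD'); rewrite /= in fW'.
rewrite bd_point // (split_topE gm); rewrite (split_topE gm') in fW' * => nz.
have [j /eqP fj] : exists j : 'I_d.+2, face d.+1 j (split m' g') == g.
  apply/existsP; apply: contraNT nz => /existsPn nf.
  by rewrite big1 // => j _; rewrite (negPf (nf j)) mulr0.
have jd : (j <= d.+1)%N by rewrite -ltnS.
have [e|lt] := weight_split_lt gW gW' gm gm' jd fj; last by right.
by left; apply/val_inj.
Qed.

Lemma dim_cycles_rank d : 
  (\dim (cycles F n d) + \dim (bd F d (onto n d) @: supported F (onto n d.+1)))%N
    = #|onto n d.+1|.
Proof. by rewrite limg_ker_dim dim_supported. Qed.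

Lemma dim_boundaries_0 : \dim (bd F 0 (onto n 0) @: supported F (onto n 1)) = 0%N.
Proof.
apply/eqP; rewrite dimv_eq0 -subv0; apply/subvP => _ /memv_imgP[c _ ->].
rewrite memv0; apply/eqP/ffunP => g; rewrite bdE ffunE.
by case: ifP => // /onto_gt0.
Qed.

(** Periods give one inequality. For the other, the two kinds of matched words in [card_onto_le] are
    bounded by the ranks of the incoming and the outgoing boundary, and rank-nullity concludes. *)
Lemma dim_cycles d :
  \dim (cycles F n d) = (\dim (boundaries F n d) + #|sorted_words n 0 d.+1|)%N.
Proof.
have ge : (\dim (boundaries F n d) + #|sorted_words n 0 d.+1| <= \dim (cycles F n d))%N.
  rewrite -(@dim_cap_periods F n d (cycles F n d)).
    by rewrite leq_add2r; apply: dimvS; apply: boundaries_periods.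
  by move=> f /sorted_wordsP[fW _ _]; apply: alternation_cycle.
apply/eqP; rewrite eqn_leq ge andbT.
have squeeze (z b b' w a p p' : nat) : (p <= b' -> p' <= b -> w <= a + p + p' ->
    z + b = w -> z <= b' + a)%N by lia.
apply: (squeeze _ _ _ _ _ _ _ (card_splittables_le d) _ (card_onto_le n d.+1)
          (dim_cycles_rank d)).
case: d {ge} => [|d]; last exact: card_splittables_le.
rewrite dim_boundaries_0 leqn0 cards_eq0; apply/eqP/setP => g.
by rewrite in_set0; apply/splittablesP => -[/onto_gt0].
Qed.

Lemma boundaries_period_kernel d :
  boundaries F n d = (cycles F n d :&: lker (periods F n d))%VS.
Proof.
apply/eqP; rewrite eqEdim boundaries_periods.
have := dim_cap_periods (F := F) (d := d) (U := cycles F n d); rewrite dim_cycles.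
rewrite andTb -(leq_add2r #|sorted_words n 0 d.+1|) => -> // f.
by case/sorted_wordsP=> fW _ _; apply: alternation_cycle.
Qed.

End Rank.

(** * Words with a letter of k vertices *)

Section Crowded.

Variables (n k : nat).
Implicit Types (f g h : placement n) (s t i j p : nat) (u v w : 'I_n.+1).

Definition letter f p : {set 'I_n.+1} := [set v | f v == p :> nat].

Lemma letterP f p v : reflect (f v = p :> nat) (v \in letter f p).
Proof. by rewrite inE; apply: eqP. Qed.

Definition load f p : nat := #|letter f p|.

Definition crowded s : {set placement n} :=
  [set f in onto n s | [exists p : 'I_s, k <= load f p]%N].

Lemma crowdedP s f :
  reflect (f \in onto n s /\ exists p, (k <= load f p)%N /\ (p < s)%N)
          (f \in crowded s).
Proof.
rewrite [f \in crowded s]in_set; apply: (iffP andP) => -[fW].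
  by case/existsP=> p kp; split=> //; exists p; rewrite ltn_ord.
by case=> p [kp ps]; split=> //; apply/existsP; exists (Ordinal ps).
Qed.

Lemma sum_card_letter s f : f \in onto n s -> (\sum_(j < s) load f j = n.+1)%N.
Proof.
move=> fW; rewrite -[RHS]card_ord -sum1_card.
rewrite (partition_big (fun v => Ordinal (onto_lt v fW)) predT) //=.
by apply: eq_bigr => j _; rewrite /load -sum1_card; apply: eq_bigl => v; rewrite inE.
Qed.

Lemma letter_gt0 s f j : f \in onto n s -> (j < s)%N -> (0 < load f j)%N.
Proof. by move=> fW /(onto_ex fW)[v fv]; apply/card_gt0P; exists v; apply/letterP. Qed.

(** The total excess over single vertices depends only on the number of letters; a letter with [k]
    vertices uses up [k - 1] of it. *)
Lemma sum_card_letter_pred s f : f \in onto n s ->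
  (\sum_(j < s) (load f j).-1 = n.+1 - s)%N.
Proof.
move=> fW; have := sum_card_letter fW.
have -> : (\sum_(j < s) load f j = \sum_(j < s) (load f j).-1 + s)%N.
  rewrite -[X in (_ + X)%N]card_ord -sum1_card -big_split /=.
  by apply: eq_bigr => j _; rewrite addn1 prednK // (letter_gt0 fW).
by move=> e; rewrite -[LHS](addnK s) e.
Qed.

Lemma crowded_n_lt s f : f \in crowded s -> (n.+2 < s + k)%N -> False.
Proof.
case/crowdedP=> fW [p [kp ps]] nsk; have sn := onto_le fW.
have := sum_card_letter_pred fW; rewrite (bigD1 (Ordinal ps)) //=; lia.
Qed.

(* Words with t letters, one of which may have k vertices; the others are then
   single vertices. *)
Variable t : nat.
Hypotheses (tk : (t + k = n.+2)%N) (k_ge3 : (3 <= k)%N).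

(** With [t = n + 2 - k] letters the total excess is exactly [k - 1], so a big letter exhausts
    it. *)
Lemma crowded_letter f p : f \in onto n t -> (k <= load f p)%N ->
  load f p = k
  /\ forall u v, f u = f v :> nat -> f u <> p :> nat -> u = v.
Proof.
move=> fW kp.
have [v0 fv0] : exists v, f v = p :> nat.
  by have /card_gt0P[v /letterP fv] : (0 < load f p)%N by [lia]; exists v.
have pt : (p < t)%N by rewrite -fv0 onto_lt.
have := sum_card_letter_pred fW; rewrite (bigD1 (Ordinal pt)) //=.
set r := (\sum_(j < t | _) _)%N => e; split; first by lia.
have r0 : r = 0%N by lia.
move=> u v fuv fup; pose j := Ordinal (onto_lt u fW).
have /eqP := r0; rewrite sum_nat_eq0 => /forallP/(_ j); rewrite -val_eqE /=.
case: eqP => //= _ /eqP; have := letter_gt0 fW (ltn_ord j) => /= gt0 le1.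
have /cards1P[w we] : load f (f u) == 1%N by apply/eqP; lia.
have : u \in letter f (f u) by apply/letterP.
have : v \in letter f (f u) by apply/letterP.
by rewrite we !inE => /eqP -> /eqP ->.
Qed.

Definition crowd f : nat :=
  if [pick p : 'I_n.+1 | k <= load f p]%N is Some p then p else 0%N.

Lemma crowdE f p : f \in onto n t -> (k <= load f p)%N -> crowd f = p.
Proof.
move=> fW kp; have /card_gt0P[v /letterP fv] : (0 < load f p)%N by lia.
rewrite /crowd; case: pickP => [q kq|/(_ (f v))]; last by rewrite fv kp.
have [_ single] := crowded_letter fW kp; apply/eqP/negP => /negP/eqP qp.
have /card_gt1P[u [w [/letterP fu /letterP fw]]] : (1 < load f q)%N by lia.
by case/eqP; apply: single; rewrite fu ?fw.
Qed.

Lemma crowd_spec f : f \in crowded t ->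
  [/\ f \in onto n t, (k <= load f (crowd f))%N
    & forall u v, f u = f v :> nat -> f u <> crowd f :> nat -> u = v].
Proof.
case/crowdedP=> fW [p [kp _]]; rewrite (crowdE fW kp); split=> //.
by have [] := crowded_letter fW kp.
Qed.

Lemma sorted_words_letter p f : (p <= 1)%N -> f \in sorted_words n p t ->
  load f p = k.
Proof.
move=> p1 fS; have /sorted_wordsP[fW _ z] := fS.
have pt : (p < t)%N.
  case: (ltnP p t) => // tp; have t_gt0 := onto_gt0 fW.
  have := z ord_max; have := onto_lt ord_max fW => lt /(_ ltac:(lia)).
  by move/(congr1 val) => /=; lia.
have := card_above fS pt; have := cardsC (above p f); rewrite card_ord.
have [p0|{}p1] : p = 0%N \/ p = 1%N by lia.
  have -> : ~: above p f = letter f p.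
    by apply/setP => v; rewrite !inE p0; case: (nat_of_ord (f v)).
  by rewrite -/(load f p) => e1 e2; move: e1; rewrite e2; lia.
have -> : ~: above p f = ord0 |: letter f p.
  apply/setP => v; rewrite !inE p1 -leqNgt; apply/idP/orP => [|[/eqP->|/eqP->//]].
    rewrite leq_eqVlt => /orP[->|]; first by right.
    by rewrite ltnS leqn0 => /eqP fv; left; apply/eqP/z; rewrite p1 fv.
  by rewrite (onto_0 fW).
rewrite cardsU1 -/(load f p); have -> : ord0 \notin letter f p.
  by apply/negP => /letterP; rewrite (onto_0 fW) p1.
by rewrite /= => e1 e2; move: e1; rewrite e2; lia.
Qed.

Lemma sorted_words_crowded p f : (p <= 1)%N -> f \in sorted_words n p t ->
  f \in crowded t.
Proof.
move=> p1 fS; have /sorted_wordsP[fW _ _] := fS; have fp := sorted_words_letter p1 fS.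
apply/crowdedP; split=> //; exists p; rewrite fp leqnn; split=> //.
have /card_gt0P[v /letterP <-] : (0 < load f p)%N by lia.
exact: onto_lt.
Qed.

Lemma sorted_words_crowd p f : (p <= 1)%N -> f \in sorted_words n p t -> crowd f = p.
Proof.
move=> p1 fS; have /sorted_wordsP[fW _ _] := fS.
by apply: crowdE; rewrite // (sorted_words_letter p1 fS).
Qed.

Lemma letter_relabel (r : {perm 'I_n.+1}) f (j : 'I_n.+1) :
  letter (relabel r f) (r j) = letter f j.
Proof. by apply/setP => v; rewrite !inE ffunE !val_eqE (inj_eq perm_inj). Qed.

Lemma relabel_crowded r f : perm_on (inner n t) r -> f \in crowded t ->
  relabel r f \in crowded t.
Proof.
move=> rI /crowdedP[fW [p [kp pt]]]; apply/crowdedP; split; first exact: relabel_onto.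
have pn : (p < n.+1)%N by rewrite (leq_trans pt) ?(onto_le fW).
exists (r (Ordinal pn)); rewrite /load letter_relabel; split=> //.
by rewrite (inner_perm_lt rI).
Qed.

(** One word for each subtorus: [p = 0] if the coinciding vertices include [ord0], [p = 1]
    otherwise. *)
Definition canonical : {set placement n} := sorted_words n 0 t :|: sorted_words n 1 t.

Lemma sorted_words_01 f : f \in sorted_words n 0 t -> f \in sorted_words n 1 t -> False.
Proof.
move=> f0 f1; have := sorted_words_crowd (leq0n 1) f0.
by rewrite (sorted_words_crowd (leqnn 1) f1).
Qed.

(** Relabeling preserves the letter of [ord0], so it cannot mix the two kinds, and [above p]
    determines a sorted word. Hence, among canonical words, an alternation is nonzero only at its
    own word. *)
Lemma canonical_relabel r f : perm_on (inner n t) r ->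
  f \in canonical -> relabel r f \in canonical -> r = 1%g.
Proof.
move=> rI; have tn : (t <= n)%N by lia.
have no01 g h : g \in sorted_words n 0 t -> h \in sorted_words n 1 t ->
    (forall v, g v = ord0 -> h v = ord0) -> False.
  move=> gS hS gh; have [u [v [uv gu gv]]] := sorted_words_collision gS tn.
  have /sorted_wordsP[_ _ z] := hS.
  have hz w : g w = 0%N :> nat -> w = ord0.
    by move=> gw; apply: z; rewrite gh //; apply/val_inj.
  by case/eqP: uv; rewrite (hz u) // (hz v).
rewrite !in_setU => /orP[fS|fS] /orP[rS|rS].
- have /sorted_wordsP[fW _ _] := fS; have := sorted_words_relabel_0 rI fS rS.
  have -> : matches (relabel r f) (relabel r f) by apply/matchesP.
  by move/esym/andP=> [_ /eqP].
- case: (no01 _ _ fS rS) => v fv; by rewrite ffunE fv (inner_perm0 rI).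
- case: (no01 _ _ rS fS) => v; rewrite ffunE => rv.
  by apply: (@perm_inj _ r); rewrite rv (inner_perm0 rI).
have /sorted_wordsP[fW _ _] := fS; have /sorted_wordsP[rfW rsrt _] := rS.
have [u [v [uv fu fv]]] := sorted_words_collision fS tn.
(* Position 1 of [f] holds two vertices, which a sorted word admits nowhere beyond 1; and [r]
   already fixes 0. *)
have r1 (j : 'I_n.+1) : j = 1%N :> nat -> r j = j.
  move=> j1; apply/val_inj; rewrite /= j1; apply/eqP; rewrite eqn_leq leqNgt.
  have fj w : f w = 1%N :> nat -> f w = j by move=> fw; apply/val_inj; rewrite /= fw.
  apply/andP; split; first apply/negP => rj.
    case/eqP: uv; apply: (sorted_above_inj rsrt); first by rewrite ffunE (fj u).
    by rewrite !ffunE (fj u) // (fj v).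
  rewrite lt0n; apply/negP => /eqP rj; have e : r j = r ord0.
    by apply/val_inj; rewrite /= rj (inner_perm0 rI).
  by have := perm_inj e => j0; rewrite j0 in j1.
have eqf : relabel r f = f.
  apply: (above_inj (leqnn 1) rS fS); apply/eqP.
  rewrite eqEcard (card_above fS) ?(card_above rS); [|by have := onto_lt u fW; lia..].
  rewrite leqnn andbT; apply/subsetP => w; rewrite !inE ffunE ltnNge => rw.
  rewrite ltnNge; apply: contra rw; rewrite leq_eqVlt => /orP[/eqP fw|].
    by rewrite r1 // fw.
  rewrite ltnS leqn0 => /eqP fw; have -> : f w = ord0 by apply/val_inj.
  by rewrite (inner_perm0 rI).
apply: (relabel_id rI fW) => w _.
by have /ffunP/(_ w) := eqf; rewrite ffunE.
Qed.

Lemma card_canonical :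
  #|canonical| = (#|sorted_words n 0 t| + #|sorted_words n 1 t|)%N.
Proof.
rewrite cardsU (_ : _ :&: _ = set0) ?cards0 ?subn0 //.
apply/setP => f; rewrite in_setI in_set0; apply/negP => /andP[].
exact: sorted_words_01.
Qed.

End Crowded.

(** * Cycles of top-dimensional crowded words *)

Section CrowdedFaces.

Variables (n k d : nat).
Hypotheses (dk : (d.+1 + k = n.+2)%N) (k_ge3 : (3 <= k)%N).
Implicit Types (f g h : placement n) (i j : nat) (u v w : 'I_n.+1).
Local Notation crowd := (crowd k).
Local Notation crowded := (crowded n k d.+1).

Section TwoFaces.

Variables (f h : placement n) (i j : nat) (a b : 'I_n.+1).
Hypotheses (fC : f \in crowded) (hC : h \in crowded).
Hypotheses (i_lt : (i < d)%N) (j_le : (j <= d)%N).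
Hypotheses (fa : f a = i :> nat) (fb : f b = i.+1 :> nat).
Hypotheses (crowd_i : crowd f <> i) (crowd_i1 : crowd f <> i.+1).
Hypothesis fh : face d j h = face d i f.

Let fW : f \in onto n d.+1. Proof. by case/crowdedP: fC. Qed.
Let hW : h \in onto n d.+1. Proof. by case/crowdedP: hC. Qed.

Let f_single u v : f u = f v :> nat -> f u <> crowd f :> nat -> u = v.
Proof. by have [_ _] := crowd_spec dk k_ge3 fC; apply. Qed.

Let h_single u v : h u = h v :> nat -> h u <> crowd h :> nat -> u = v.
Proof. by have [_ _] := crowd_spec dk k_ge3 hC; apply. Qed.

Let fhE v : face d j h v = (f v - (i < f v)%N)%N :> nat.
Proof. by rewrite fh face_inner. Qed.

Let merged u v : u <> v -> f u <> crowd f :> nat ->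
  face d j h u = face d j h v -> (u = a /\ v = b) \/ (u = b /\ v = a).
Proof.
move=> uv fu /(congr1 val) /=; rewrite !fhE => e.
have fuv : f u <> f v :> nat by move=> fuv; case: uv; apply: f_single.
have [[fui fvi]|[fui fvi]] :
    (f u = i :> nat /\ f v = i.+1 :> nat) \/ (f u = i.+1 :> nat /\ f v = i :> nat) by lia.
  by left; split; apply: f_single; rewrite ?fui ?fvi ?fa ?fb //; apply/nesym.
by right; split; apply: f_single; rewrite ?fui ?fvi ?fa ?fb //; apply/nesym.
Qed.

(** In the face, a vertex [u] of the big letter of [h] shares its position with at least two others,
    as [3 <= k]. If it were a single vertex of [f], the face of [f] could join it to at most one,
    through the pair [a], [b]. *)
Let crowd_sub u : h u = crowd h :> nat -> f u = crowd f :> nat.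
Proof.
move=> hu; apply/eqP/negPn/negP => /eqP fu.
have other v : h v = crowd h :> nat -> u <> v -> (u = a /\ v = b) \/ (u = b /\ v = a).
  move=> hv uv; apply: merged => //; apply/val_inj.
  by rewrite /= !faceE ?hu ?hv //; lia.
have [_ kh _] := crowd_spec dk k_ge3 hC.
have /card_gt2P[x [y [z [[hx hy hz] [xy yz zx]]]]] : (2 < load h (crowd h))%N by lia.
move/letterP: hx => hx; move/letterP: hy => hy; move/letterP: hz => hz.
have ab : a <> b by move=> ab; move: fb; rewrite -ab fa; lia.
have two v w : h v = crowd h :> nat -> h w = crowd h :> nat -> u <> v -> u <> w -> v = w.
  move=> hv hw uv uw.
  by case: (other v hv uv) => -[ua ->]; case: (other w hw uw) => -[ua' ->] //;
    case: ab; rewrite -ua -ua'.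
have [ux|ux] := eqVneq u x.
  by case/eqP: yz; apply: two; rewrite // ux; apply/eqP; rewrite // eq_sym.
have [uy|uy] := eqVneq u y.
  by case/eqP: zx; apply: two; rewrite // uy; apply/eqP; rewrite // eq_sym.
by case/eqP: xy; apply: two => //; apply/eqP.
Qed.

Let crowd_eq u : (h u == crowd h :> nat) = (f u == crowd f :> nat).
Proof.
have [_ kh _] := crowd_spec dk k_ge3 hC; have [_ kf _] := crowd_spec dk k_ge3 fC.
have [lh _] := crowded_letter dk k_ge3 hW kh.
have [lf _] := crowded_letter dk k_ge3 fW kf.
suff e : letter h (crowd h) = letter f (crowd f).
  by have := congr1 (fun A : {set _} => u \in A) e; rewrite !inE.
apply/eqP; rewrite eqEcard -!/(load _ _) lh lf leqnn andbT.
by apply/subsetP => v /letterP hv; apply/letterP/crowd_sub.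
Qed.

Let ha : h a <> crowd h :> nat.
Proof. by move/eqP; rewrite crowd_eq fa => /eqP/nesym. Qed.

Let hb : h b <> crowd h :> nat.
Proof. by move/eqP; rewrite crowd_eq fb => /eqP/nesym. Qed.

Let hab : h a <> h b :> nat.
Proof. by move=> /h_single/(_ ha) ab; move: fb; rewrite -ab fa; lia. Qed.

Let ex_crowd : exists w, h w = crowd h :> nat /\ f w = crowd f :> nat.
Proof.
have [_ kh _] := crowd_spec dk k_ge3 hC.
have /card_gt0P[w /letterP hw] : (0 < load h (crowd h))%N by lia.
by exists w; split=> //; apply: crowd_sub.
Qed.

(** The vertex [b] absorbed by the first letter stood at position 1 or at the end; in the latter
    case the big letter stands one place earlier. *)
Lemma crowded_face_0 : i = 0%N -> (1 < crowd f)%N ->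
  h = f /\ j = 0%N \/ (crowd h < crowd f)%N.
Proof.
move=> i0 cf; have ga := fhE a; have gb := fhE b; rewrite fa fb i0 /= in ga gb.
have a0 : a = ord0.
  by apply: f_single; rewrite fa ?(onto_0 fW) ?i0 //=; lia.
have ha0 : h a = 0%N :> nat by rewrite a0 (onto_0 hW).
have [jd|jd] : j = d \/ (j < d)%N by lia.
  right; have [w [hw fw]] := ex_crowd; have := fhE w.
  have d0 : (0 < d)%N by lia.
  by rewrite jd face_last // hw fw i0; case: eqP; lia.
left; have hgE v := face_inner v hW jd; rewrite hgE in gb.
have j0 : j = 0%N by lia.
split=> //; apply/ffunP => v; apply/val_inj => /=.
have := fhE v; rewrite hgE i0 j0; have [->|va] := eqVneq v a; first by rewrite ha0 fa i0.
have fv : f v <> 0%N :> nat.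
  by move=> fv; case/eqP: va; apply: f_single; rewrite fv ?fa //; lia.
have hv : h v <> 0%N :> nat.
  by move=> hv; case/eqP: va; apply/esym/h_single => //; rewrite ha0.
by lia.
Qed.

(** The only other crowded word with this face has [a] and [b] exchanged, and moving the greater
    vertex to the right increases the sum. *)
Lemma crowded_face_inner : (0 < i)%N -> (b < a)%N ->
  h = f /\ j = i \/
  (crowd h = crowd f /\ \sum_(v < n.+1) v * f v < \sum_(v < n.+1) v * h v)%N.
Proof.
move=> i0 ba; have ga := fhE a; have gb := fhE b; rewrite fa fb in ga gb.
have jd : (j < d)%N.
  have [jd|//] : j = d \/ (j < d)%N by lia.
  by move: ga gb; rewrite jd !face_last //; [do !case: eqP; lia|lia..].
have hgE v := face_inner v hW jd; rewrite !hgE in ga gb.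
have ji : j = i by move: ga gb hab; clear; lia.
have habE : (h a = i :> nat /\ h b = i.+1 :> nat) \/ (h a = i.+1 :> nat /\ h b = i :> nat).
  by move: ga gb hab; rewrite ji; clear; lia.
have others v : v <> a -> v <> b -> h v = f v :> nat.
  move=> va vb; have := fhE v; rewrite hgE ji.
  have fva : f v <> f a :> nat.
    by move=> e; case: va; apply/esym/f_single => //; rewrite fa; apply/nesym.
  have fvb : f v <> f b :> nat.
    by move=> e; case: vb; apply/esym/f_single => //; rewrite fb; apply/nesym.
  have hva : h v <> h a :> nat by move=> e; case: va; apply/esym/h_single.
  have hvb : h v <> h b :> nat by move=> e; case: vb; apply/esym/h_single.
  move: fva fvb; rewrite fa fb => fva fvb.
  have [hvi hvi1] : h v <> i :> nat /\ h v <> i.+1 :> nat.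
    by move: hva hvb; case: habE => -[-> ->].
  by move: fva fvb hvi hvi1; clear; lia.
case: habE => -[hai hbi].
  left; split=> //; apply/ffunP => v; apply/val_inj => /=.
  have [->|/eqP va] := eqVneq v a; first by rewrite hai fa.
  have [->|/eqP vb] := eqVneq v b; first by rewrite fb.
  exact: others.
right.
have [w [hw fw]] := ex_crowd; split.
  rewrite -hw -fw others // => e; first by move: fw; rewrite e fa; apply/nesym.
  by move: fw; rewrite e fb; apply/nesym.
have ab : b != a by apply/eqP => ab; rewrite ab ltnn in ba.
rewrite (bigD1 a) //= (bigD1 b) //= [X in (_ < X)%N](bigD1 a) //=.
rewrite [X in (_ < _ + X)%N](bigD1 b) //= fa fb hai hbi.
rewrite [X in (_ + (_ + X) < _)%N](eq_bigr (fun v : 'I_n.+1 => v * h v)%N).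
  by rewrite !addnA ltn_add2r; nia.
by move=> v /andP[/eqP va /eqP vb]; rewrite others.
Qed.

End TwoFaces.

Variable F : numFieldType.
Implicit Types c : placement_chain F n.

(** A lexicographic order as one number to minimize: the factor exceeds every weighted sum, so the
    position of the big letter dominates. *)
Let key f : nat :=
  (crowd f * (\sum_(v < n.+1) v * n).+1
   + ((\sum_(v < n.+1) v * n).+1 - \sum_(v < n.+1) v * f v))%N.

Let key_crowd f h : (crowd h < crowd f)%N -> (key h < key f)%N.
Proof.
have le g : (\sum_(v < n.+1) v * g v <= \sum_(v < n.+1) v * n)%N.
  by apply: leq_sum => v _; rewrite leq_mul2l leq_ord orbT.
by rewrite /key; have := le f; have := le h; move: (\sum_(v < n.+1) _)%N => B; nia.
Qed.

Let key_sum f h : crowd h = crowd f ->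
  (\sum_(v < n.+1) v * f v < \sum_(v < n.+1) v * h v)%N -> (key h < key f)%N.
Proof.
have le g : (\sum_(v < n.+1) v * g v <= \sum_(v < n.+1) v * n)%N.
  by apply: leq_sum => v _; rewrite leq_mul2l leq_ord orbT.
by rewrite /key; have := le f; have := le h; move: (\sum_(v < n.+1) v * n)%N => B; lia.
Qed.

(* Take a crowded word f in the support of the cycle for which the position of
   the big letter is least and then \sum v * f v is greatest.  Unless f is
   canonical, f has a face which is not a face of any other such word. *)
Lemma crowded_cycle_eq0 c : c \in supported F crowded ->
  bd F d (onto n d) c = 0 -> (forall f, f \in canonical n d.+1 -> c f = 0) -> c = 0.
Proof.
move=> /supportedP cC bd0 can0; apply/eqP; apply: contraT => /eqP c_neq0.
have [f0 cf0] : exists f, c f != 0.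
  apply/existsP; apply: contra_notT c_neq0 => /existsPn c0.
  by apply/ffunP => f; rewrite ffunE; apply/eqP/negPn.
case: (arg_minnP (P := [pred f | c f != 0]) key cf0) => f /= cf fmin {f0 cf0}.
have inC h : c h != 0 -> h \in crowded by apply: contraNT => /cC ->.
have fC := inC f cf; have [fW kf single] := crowd_spec dk k_ge3 fC.
(* A face that occurs in no other way in the support has coefficient [c f] up to sign in the
   boundary. *)
have isolated i a : (i < d)%N -> f a = i :> nat ->
    (forall h j, c h != 0 -> (j <= d)%N -> face d j h = face d i f -> h = f /\ j = i) ->
    False.
  move=> i_d fa alone; have d0 : (0 < d)%N by lia.
  have gW : face d i f \in onto n d by apply: face_onto => //; apply: ltnW.
  have := congr1 (fun c' : placement_chain F n => c' (face d i f)) bd0.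
  rewrite bdE gW ffunE (bigD1 (Ordinal (ltnW i_d : (i < d.+1)%N))) //=.
  rewrite [X in _ + X]big1 ?addr0 => [|j ji].
    rewrite (bigD1 f) /=; last by rewrite fW eqxx.
    rewrite big1 ?addr0 => [/eqP|h /andP[/andP[hW /eqP fh] hf]].
      by rewrite mulf_eq0 signr_eq0 (negPf cf).
    apply/eqP; apply: contraNT hf => ch; apply/eqP.
    by case: (alone h i ch (ltnW i_d) fh).
  rewrite big1 ?mulr0 // => h /andP[hW /eqP fh].
  apply/eqP; apply: contraNT ji => ch; apply/eqP/val_inj => /=.
  by case: (alone h j ch _ fh) => //; rewrite -ltnS.
have not_lt h : c h != 0 -> (key h < key f)%N -> False.
  by move=> /fmin; rewrite leqNgt => /negP.
(* With the big letter beyond position 1, the face 0 merges two single vertices and is isolated. *)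
have cf1 : (crowd f <= 1)%N.
  rewrite leqNgt; apply/negP => cf1.
  have cfd : (crowd f < d.+1)%N.
    have /card_gt0P[w /letterP <-] : (0 < load f (crowd f))%N by lia.
    exact: onto_lt.
  have [|b fb] := onto_ex (j := 1) fW; first lia.
  have f0 : f ord0 = 0%N :> nat by rewrite (onto_0 fW).
  have d0 : (0 < d)%N by lia.
  apply: (isolated 0%N ord0) => // h j ch jd fh.
  have [||//|lt] := crowded_face_0 fC (inC h ch) d0 jd f0 fb _ _ fh (erefl _) cf1; try lia.
  by case: (not_lt h ch); apply: key_crowd.
case/eqP: cf; apply: can0; rewrite in_setU.
(* A descent beyond the big letter would give an isolated inner face. *)
have srt : sorted_above (crowd f) f.
  apply: (sorted_above_ascending fW) => [u v pu fvu|a pa ad].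
    by apply: single => //; lia.
  have [b fb] := onto_ex fW ad.
  apply/ascendingP; split=> [v fv|]; first by apply: single => //; lia.
  exists b; split=> //; rewrite ltnNge leq_eqVlt; apply/negP => /orP[/eqP/val_inj e|ba].
    by move: fb; rewrite e; lia.
  apply: (isolated (f a) a) => // h j ch jd fh.
  have a0 : (0 < f a)%N by apply: leq_ltn_trans pa.
  have ca : crowd f <> f a by move=> e; rewrite -e ltnn in pa.
  have ca1 : crowd f <> (f a).+1 by move=> e; rewrite e ltnNge leqnSn in pa.
  have [//|[e lt]] := crowded_face_inner fC (inC h ch) (ad : (f a < d)%N) jd
    (erefl _) fb ca ca1 fh a0 ba.
  by case: (not_lt h ch); apply: key_sum.
have [e|e] : crowd f = 0%N \/ crowd f = 1%N by lia.
  by rewrite e in srt; apply/orP; left; apply/sorted_wordsP.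
rewrite e in srt single; apply/orP; right; apply/sorted_wordsP; split=> // v.
by rewrite ltnS leqn0 => /eqP fv; apply: single; rewrite ?fv ?(onto_0 fW).
Qed.

Let crowded_cycles : {vspace placement_chain F n} :=
  (supported F crowded :&: lker (bd F d (onto n d)))%VS.

Let alternation_crowded f : f \in canonical n d.+1 ->
  alternation F d.+1 f \in crowded_cycles.
Proof.
rewrite in_setU memv_cap memv_ker => fS.
rewrite (alternating_cycle (@alternation_alternating _ _ _ f)) eqxx andbT.
apply: alternation_supported => r rI; apply: relabel_crowded => //.
by case/orP: fS; apply: sorted_words_crowded => //.
Qed.

Let alternation_eval f g : f \in canonical n d.+1 -> g \in canonical n d.+1 ->
  alternation F d.+1 f g = (g == f)%:R.
Proof.
move=> fS gS; rewrite ffunE.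
have id_f : relabel 1 f = f by apply/ffunP => v; rewrite ffunE perm1.
rewrite (bigD1 1%g) ?perm_on1 //= odd_perm1 mul1r big1 => [|r /andP[rI /eqP r1]].
  by rewrite addr0 id_f eq_sym.
case: eqP => [e|]; last by rewrite mulr0.
by case: r1; apply: (canonical_relabel dk k_ge3 rI fS); rewrite e.
Qed.

Let dim_crowded_cycles : \dim crowded_cycles = #|canonical n d.+1|.
Proof.
rewrite -card_sig; pose Y : finType := {f | f \in canonical n d.+1}.
apply: (@dim_values F _ Y _ (fun y : Y => eval F (val y))
          (fun y : Y => alternation F d.+1 (val y))).
- by case=> f fS; apply: alternation_crowded.
- by move=> [f fS] [g gS]; rewrite evalE alternation_eval.
move=> c; rewrite memv_cap memv_ker => /andP[cC /eqP bd0] c0.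
apply: crowded_cycle_eq0 => // f fS.
by have := c0 (exist _ f fS); rewrite evalE.
Qed.

(** These are the cycles of X without periods. The alternations of [sorted_words n 0 d.+1] lie in X
    and realize all periods, so their number is subtracted from that of the canonical words. *)
Lemma dim_boundaries_crowded :
  \dim (boundaries F n d :&: supported F crowded) = #|sorted_words n 1 d.+1|.
Proof.
rewrite boundaries_period_kernel.
have -> : (cycles F n d :&: lker (periods F n d) :&: supported F crowded)%VS =
    (crowded_cycles :&: lker (periods F n d))%VS.
  have sub : (supported F crowded <= supported F (onto n d.+1))%VS.
    by apply: supportedS; apply/subsetP => f /crowdedP[].
  by rewrite capvC /cycles !capvA (capv_idPl sub).
have := @dim_cap_periods F n d crowded_cycles.
rewrite dim_crowded_cycles (card_canonical dk k_ge3) => e; apply/eqP.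
rewrite -(eqn_add2r #|sorted_words n 0 d.+1|) e => [|f fS]; first by rewrite addnC.
by apply: alternation_crowded; rewrite in_setU fS.
Qed.

Lemma dim_boundaries_cut :
  (\dim (linfun (cut_fun crowded) @: boundaries F n d) + #|sorted_words n 1 d.+1|)%N
  = \dim (boundaries F n d).
Proof.
by rewrite -dim_boundaries_crowded addnC; apply: limg_ker_dim.
Qed.

End CrowdedFaces.

(** * The complex of the algebra *)

Section Comparison.

(* An isomorphism of complexes, with the source given by subspaces of one
   ambient space. *)
Variables (K : fieldType) (V C2 C1 C0 : vectType K) (U2 U1 U0 : {vspace V}).
Variables (r2 : 'Hom(V, C2)) (r1 : 'Hom(V, C1)) (r0 : 'Hom(V, C0)).
Variables (e1 e0 : 'End(V)) (d1 : 'Hom(C2, C1)) (d0 : 'Hom(C1, C0)).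
Hypotheses (r2_full : (r2 @: U2 = fullv)%VS) (r1_full : (r1 @: U1 = fullv)%VS).
Hypotheses (r1_inj : (U1 :&: lker r1 = 0)%VS) (r0_inj : (U0 :&: lker r0 = 0)%VS).
Hypotheses (e1_sub : forall c, e1 c \in U1) (e0_sub : forall c, e0 c \in U0).
Hypothesis d1r : forall c, c \in U2 -> d1 (r2 c) = r1 (e1 c).
Hypothesis d0r : forall c, c \in U1 -> d0 (r1 c) = r0 (e0 c).
Hypothesis e01 : forall c, e0 (e1 c) = 0.

Lemma dim_homology_comparison :
  (\dim (lker d0 :\: limg d1) + \dim (e0 @: U1) + \dim (e1 @: U2))%N = \dim U1.
Proof.
have limg1 : limg d1 = (r1 @: (e1 @: U2))%VS.
  rewrite -r2_full -!limg_comp; apply: eq_in_limg => c cU.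
  by rewrite !comp_lfunE d1r.
have limg0 : limg d0 = (r0 @: (e0 @: U1))%VS.
  rewrite -r1_full -!limg_comp; apply: eq_in_limg => c cU.
  by rewrite !comp_lfunE d0r.
have img_cap (W U W' : {vspace V}) : (W <= U)%VS -> (U :&: W' = 0)%VS -> (W :&: W' = 0)%VS.
  by move=> WU UW'; apply/eqP; rewrite -subv0 -UW' capvS.
have dim1 : \dim (limg d1) = \dim (e1 @: U2).
  rewrite limg1 limg_dim_eq //; apply: img_cap r1_inj.
  by apply/subvP => _ /memv_imgP[c _ ->].
have dim0 : \dim (limg d0) = \dim (e0 @: U1).
  rewrite limg0 limg_dim_eq //; apply: img_cap r0_inj.
  by apply/subvP => _ /memv_imgP[c _ ->].
have sub : (limg d1 <= lker d0)%VS.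
  rewrite limg1; apply/subvP => _ /memv_imgP[_ /memv_imgP[c _ ->] ->].
  by rewrite memv_ker d0r // e01 linear0.
have dimU : \dim (fullv : {vspace C1}) = \dim U1 by rewrite -r1_full limg_dim_eq.
have := limg_ker_dim d0 fullv; rewrite capfv dim0 dimU => <-.
have := dimv_cap_compl (lker d0) (limg d1); rewrite (capv_idPr sub) dim1 => <-.
by rewrite addnAC [X in (X + _)%N]addnC.
Qed.

End Comparison.

Lemma cap_lker0 (K : fieldType) (V W : vectType K) (U : {vspace V}) (f : 'Hom(V, W)) :
  (forall c, c \in U -> f c = 0 -> c = 0) -> (U :&: lker f = 0)%VS.
Proof.
move=> f_inj; apply/eqP; rewrite -subv0; apply/subvP => c.
by rewrite memv_cap memv_ker memv0 => /andP[cU /eqP/f_inj ->].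
Qed.

Lemma limg_full (K : fieldType) (V W : vectType K) (U : {vspace V}) (f : 'Hom(V, W)) :
  (forall c, exists2 d, d \in U & f d = c) -> (f @: U = fullv)%VS.
Proof.
move=> f_surj; apply/eqP; rewrite eqEsubv subvf; apply/subvP => c _.
by have [d dU <-] := f_surj c; apply: memv_img.
Qed.

Section EdgeIdeal.

Variables (R : realType) (n : nat) (H : hypergraph n).

(** Reading off the coefficient of [D] in a combination of edge monomials shows that one of them
    divides the monomial. *)
Lemma edge_idealXP (D : 'X_{1..n}) :
  edge_ideal H 'X_[R[i], D] <-> exists2 e, e \in H & forall v, v \in e -> (0 < D v)%N.
Proof.
pose m (e : {set 'I_n}) : 'X_{1..n} := (\sum_(v in e) U_(v))%MM.
have mE e v : m e v = (v \in e).
  rewrite /m mnm_sumE; under eq_bigr => w _ do rewrite mnm1E.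
  have [ve|ve] := boolP (v \in e).
    rewrite (bigD1 v) //= eqxx big1 // => w /andP[_ /negPf wv].
    by rewrite wv.
  by rewrite big1 // => w we; case: eqP we ve => // -> ->.
have edgeE e : edge_monomial R e = 'X_[m e] by rewrite /edge_monomial /m mprodXE.
split=> [[c Dc]|[e eH eD]].
  have : ('X_[R[i], D])@_D != 0 by rewrite mcoeffX eqxx oner_neq0.
  rewrite Dc raddf_sum /= => nz.
  have [e eH ce] : exists2 e, e \in H & (c e * edge_monomial R e)@_D != 0.
    apply/exists_inP; apply: contraNT nz => /exists_inPn c0.
    by rewrite big1 // => e /c0 /negPn /eqP.
  exists e => // v ve; move: ce; rewrite -mcoeff_msupp edgeE.
  rewrite (perm_mem (msuppMX _ _)) => /mapP[m' _ ->].
  by rewrite mnmDE mE ve.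
have le : (m e <= D)%MM.
  by apply/mnm_lepP => v; rewrite mE; case: (boolP (v \in e)) => // /eD.
exists (fun e' => if e' == e then 'X_[(D - m e)%MM] else 0).
rewrite (bigD1 e) //= eqxx big1 ?addr0 => [|e' /andP[_ /negPf ->]]; last by rewrite mul0r.
by rewrite edgeE -mpolyXD submK.
Qed.

End EdgeIdeal.

Section Transport.

Variables (R : realType) (n k : nat).
Local Notation H := (complete_uniform n.+1 k).
Local Notation F := (R[i] : numFieldType).
Implicit Types (f g : placement n) (s t i j : nat) (v : 'I_n.+1).
Implicit Type D : 'X_{1..n.+1}.

Lemma nonzero_complete D :
  nonzero_in_A R H D = (#|[set v | 0 < D v]| < k)%N.
Proof.
rewrite /nonzero_in_A; apply/asboolP/idP => [nI|lt /edge_idealXP[e]].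
  rewrite ltnNge; apply/negP => /card_geqP[r [ur sr rD]]; apply: nI.
  apply/edge_idealXP; exists [set v in r]; first by rewrite inE cardsE (card_uniqP ur) sr.
  by move=> v; rewrite inE => /rD; rewrite inE.
rewrite inE => /eqP ek eD; move: lt; rewrite ltnNge -ek => /negP; apply.
by apply: subset_leq_card; apply/subsetP => v /eD; rewrite inE.
Qed.

Definition uncrowded s : {set placement n} := onto n s :\: crowded n k s.

Lemma uncrowdedP s f :
  reflect (f \in onto n s /\ forall j, (j < s)%N -> (load f j < k)%N)
          (f \in uncrowded s).
Proof.
rewrite in_setD; apply: (iffP andP) => [[nC fW]|[fW lt]]; split=> //.
  move=> j js; rewrite ltnNge; apply/negP => kj; case/negP: nC.
  by apply/crowdedP; split=> //; exists j.
by apply/negP => /crowdedP[_ [p [kp ps]]]; have := lt p ps; rewrite ltnNge kp.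
Qed.

Lemma uncrowded_onto s : uncrowded s \subset onto n s.
Proof. exact: subsetDl. Qed.

Definition letter_mnm f j : 'X_{1..n.+1} :=
  [multinom (f v == j :> nat) : nat | v < n.+1].

Definition encode s f : seq 'X_{1..n.+1} := mkseq (letter_mnm f) s.

Lemma letter_mnmE f j v : letter_mnm f j v = (f v == j :> nat).
Proof. exact: mnmE. Qed.

Lemma nth_encode s f j : (j < s)%N -> nth 0%MM (encode s f) j = letter_mnm f j.
Proof. exact: nth_mkseq. Qed.

Lemma encode_inj s f g : f \in onto n s -> g \in onto n s ->
  encode s f = encode s g -> f = g.
Proof.
move=> fW gW e; apply/ffunP => v; apply/val_inj/eqP => /=.
have := congr1 (fun w => nth 0%MM w (f v) v) e.
by rewrite !nth_encode ?(onto_lt v fW) // !letter_mnmE eqxx eq_sym; case: eqP.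
Qed.

Lemma prod_mpolyX (w : seq 'X_{1..n.+1}) :
  (\prod_(D <- w) 'X_[D] = \prod_(i < n.+1) 'X_i :> {mpoly R[i][n.+1]})
  <-> (forall v, \sum_(D <- w) D v = 1)%N.
Proof.
rewrite !mprodXE; have all1 v : (\sum_(i < n.+1) U_(i))%MM v = 1%N.
  rewrite mnm_sumE (bigD1 v) //= mnm1E eqxx big1 // => u /negPf uv.
  by rewrite mnm1E uv.
split=> [/(congr1 (mcoeff (\sum_(i < n.+1) U_(i))%MM))|w1].
  rewrite !mcoeffX eqxx; case: eqP => [e _ v|_ /eqP]; last by rewrite eq_sym oner_eq0.
  by rewrite -mnm_sumE e all1.
by congr 'X_[_]; apply/mnmP => v; rewrite all1 mnm_sumE.
Qed.

Lemma encode_is_word s f : f \in uncrowded s -> is_word R H (encode s f).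
Proof.
case/uncrowdedP=> fW lt; apply/and3P; split.
- apply/allP => D /mapP[j]; rewrite mem_iota add0n => /andP[_ js] ->; apply/andP; split.
    have [v fv] := onto_ex fW js; apply/eqP => /mnmP/(_ v).
    by rewrite letter_mnmE fv eqxx mnm0E.
  rewrite nonzero_complete; have := lt j js; rewrite /load; congr (_ < _)%N.
  by apply: eq_card => v; rewrite !inE letter_mnmE lt0b.
- apply/eqP/prod_mpolyX => v; rewrite /encode /mkseq big_map -[s]subn0.
  rewrite -/(index_iota 0 s) big_mkord (bigD1 (Ordinal (onto_lt v fW))) //=.
  rewrite letter_mnmE eqxx big1 // => j; rewrite letter_mnmE -val_eqE /= eq_sym.
  by move/negPf=> ->.
apply/forallP => v; apply/implyP => /eqP v0; apply/mnm_lepP => u.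
have s_gt0 := onto_gt0 fW; rewrite -nth0 nth_encode // letter_mnmE mnm1E.
case: eqP => // <-; rewrite (_ : v = ord0); last exact/val_inj.
by rewrite (onto_0 fW).
Qed.

Definition decode (w : seq 'X_{1..n.+1}) : placement n :=
  [ffun v => inord (find (fun D : 'X_{1..n.+1} => 0 < D v)%N w)].

Section Decode.

Variable w : seq 'X_{1..n.+1}.
Hypothesis w_word : is_word R H w.
Let pos v := find (fun D : 'X_{1..n.+1} => 0 < D v)%N w.

Let w_sum v : (\sum_(D <- w) D v = 1)%N.
Proof. by case/and3P: w_word => _ /eqP/prod_mpolyX/(_ v). Qed.

Let pos_lt v : (pos v < size w)%N.
Proof.
rewrite -has_find; apply: contraT => /hasPn w0.
by have := w_sum v; rewrite big_seq big1 // => D /w0; rewrite -eqn0Ngt => /eqP.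
Qed.

Let nth_pos v i : (i < size w)%N -> nth 0%MM w i v = (pos v == i).
Proof.
move=> iw; have := w_sum v; rewrite (big_nth 0%MM) big_mkord.
rewrite (bigD1 (Ordinal (pos_lt v))) //= => e.
have pos1 : (0 < nth 0%MM w (pos v) v)%N.
  apply: (@nth_find _ 0%MM (fun D : 'X_{1..n.+1} => 0 < D v)%N w).
  by rewrite has_find pos_lt.
have [pi|ip] := eqVneq (pos v) i; last first.
  have ji : Ordinal iw != Ordinal (pos_lt v) by rewrite -val_eqE /= eq_sym.
  by move: e pos1; rewrite (bigD1 (Ordinal iw)) //=; lia.
by rewrite -pi; move: e pos1; lia.
Qed.

Let pos_ex i : (i < size w)%N -> exists v, pos v = i.
Proof.
move=> iw; have /and3P[/allP/(_ (nth 0%MM w i)) + _ _] := w_word.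
rewrite mem_nth // => /(_ isT)/andP[wi0 _].
have [v wv] : exists v, nth 0%MM w i v != 0%N.
  apply/existsP; apply: contraNT wi0 => /existsPn w0.
  by apply/eqP/mnmP => v; rewrite mnm0E; apply/eqP/negPn.
by exists v; move: wv; rewrite nth_pos // eqb0 negbK => /eqP.
Qed.

Let size_le : (size w <= n.+1)%N.
Proof.
pose h (i : 'I_(size w)) := odflt ord0 [pick v | pos v == i].
have hK (i : 'I_(size w)) : pos (h i) = i.
  rewrite /h; case: pickP => [v /eqP //|nv].
  by have [v pv] := pos_ex (ltn_ord i); have := nv v; rewrite pv eqxx.
have := @leq_card _ _ h; rewrite !card_ord; apply => i j hij.
by apply/val_inj; rewrite /= -hK hij hK.
Qed.

Let decodeE v : decode w v = pos v :> nat.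
Proof. by rewrite ffunE inordK // (leq_trans (pos_lt v)). Qed.

Lemma decodeK : encode (size w) (decode w) = w.
Proof.
apply: (@eq_from_nth _ 0%MM); first by rewrite size_mkseq.
move=> i; rewrite size_mkseq => iw; rewrite nth_encode //; apply/mnmP => v.
by rewrite letter_mnmE decodeE nth_pos.
Qed.

Lemma decode_uncrowded : decode w \in uncrowded (size w).
Proof.
have /and3P[/allP w_all _ /forallP/(_ ord0)/implyP/(_ (eqxx _))/mnm_lepP/(_ ord0)] := w_word.
have s_gt0 : (0 < size w)%N by apply: leq_ltn_trans (pos_lt ord0).
rewrite -nth0 nth_pos // mnm1E eqxx => pos0.
apply/uncrowdedP; split.
  apply/ontoP; split=> [|v|j jw].
  - by apply/val_inj; rewrite /= decodeE; move: pos0; case: eqP.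
  - by rewrite decodeE.
  by have [v pv] := pos_ex jw; exists v; rewrite decodeE.
move=> j jw; have /andP[_] := w_all _ (mem_nth 0%MM jw).
rewrite nonzero_complete /load; congr (_ < _)%N.
by apply: eq_card => v; rewrite !inE nth_pos // decodeE lt0b.
Qed.

End Decode.

Definition placement_of s (w : word R H s) : placement n := decode (letters w).

Section PlacementOf.

Variable s : nat.
Implicit Types w : word R H s.

Let letters_word w : is_word R H (letters w). Proof. exact: valP w. Qed.

Let size_letters w : size (letters w) = s.
Proof. by rewrite size_map size_tuple. Qed.

Lemma placement_of_uncrowded w : placement_of w \in uncrowded s.
Proof. by rewrite -{2}(size_letters w); apply: decode_uncrowded. Qed.

Lemma placement_of_onto w : placement_of w \in onto n s.
Proof. exact: (subsetP (uncrowded_onto s) _ (placement_of_uncrowded w)). Qed.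

Lemma encode_placement_of w : encode s (placement_of w) = letters w.
Proof. by rewrite -{1}(size_letters w) decodeK. Qed.

Lemma letters_inj : injective (@letters R n.+1 H s).
Proof.
move=> w1 w2 /(inj_map (fun D1 D2 : 'X_{1..n.+1 < n.+2} => @val_inj _ _ _ D1 D2)) e.
by apply/val_inj/val_inj.
Qed.

Lemma placement_of_inj : injective (@placement_of s).
Proof.
by move=> w1 w2 e; apply: letters_inj; rewrite -!encode_placement_of e.
Qed.

Lemma letters_encode w f : f \in onto n s ->
  (letters w == encode s f) = (placement_of w == f).
Proof.
move=> fW; rewrite -encode_placement_of; apply/eqP/eqP => [|-> //].
by apply: encode_inj => //; apply: placement_of_onto.
Qed.

Lemma mdeg_letter_mnm f j : (mdeg (letter_mnm f j) < n.+2)%N.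
Proof.
rewrite mdegE ltnS; apply: (@leq_trans (\sum_(v < n.+1) 1)%N).
  by apply: leq_sum => v _; rewrite letter_mnmE leq_b1.
by rewrite sum1_card card_ord.
Qed.

Lemma placement_of_surj f : f \in uncrowded s -> exists w, placement_of w = f.
Proof.
move=> fU; have fW := subsetP (uncrowded_onto s) _ fU.
pose t := [tuple BMultinom (mdeg_letter_mnm f j) | j < s].
have tE : [seq bmnm E | E <- t] = encode s f.
  apply: (@eq_from_nth _ 0%MM); first by rewrite size_map size_tuple size_mkseq.
  move=> i; rewrite size_map size_tuple => iw; rewrite nth_encode //.
  rewrite (nth_map (BMultinom (mdeg_letter_mnm f 0))) ?size_tuple //.
  by rewrite -(tnth_nth _ t (Ordinal iw)) tnth_mktuple.
have tw : is_word R H [seq bmnm E | E <- t] by rewrite tE encode_is_word.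
by exists (exist _ t tw : word R H s); apply/eqP; rewrite -letters_encode // /letters /= tE.
Qed.

Lemma sum_placement_of (V : nmodType) (G : placement n -> V) :
  \sum_(w : word R H s) G (placement_of w) = \sum_(f in uncrowded s) G f.
Proof.
rewrite -(big_imset (h := @placement_of s) (A := predT)) /=; last first.
  by move=> w1 w2 _ _; apply: placement_of_inj.
apply: eq_bigl => f; apply/imsetP/idP => [[w _ ->]|/placement_of_surj[w <-]].
  exact: placement_of_uncrowded.
by exists w.
Qed.

End PlacementOf.

Lemma size_encode s f : size (encode s f) = s.
Proof. exact: size_mkseq. Qed.

Lemma size_merge_at i (w : seq 'X_{1..n.+1}) : (i.+1 < size w)%N ->
  size (merge_at i w) = (size w).-1.
Proof. by move=> iw; rewrite size_cat size_takel /= ?size_drop; lia. Qed.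

Lemma nth_merge_at i j (w : seq 'X_{1..n.+1}) : (i.+1 < size w)%N ->
  nth 0%MM (merge_at i w) j =
  if (j < i)%N then nth 0%MM w j
  else if (j == i)%N then (nth 0 w i + nth 0 w i.+1)%MM else nth 0%MM w j.+1.
Proof.
move=> iw; rewrite nth_cat size_takel; last lia.
case: (ltngtP j i) => [ji|ij|->]; first by rewrite nth_take.
  have [j' e] : exists j', (j - i = j'.+1)%N by exists (j - i).-1; lia.
  by rewrite e /= nth_drop; congr nth; lia.
by rewrite subnn.
Qed.

Lemma size_merge_ends (w : seq 'X_{1..n.+1}) : (1 < size w)%N ->
  size (merge_ends w) = (size w).-1.
Proof. by move=> w1; rewrite /= size_takel ?size_behead; lia. Qed.

Lemma nth_merge_ends j (w : seq 'X_{1..n.+1}) : (j.+1 < size w)%N ->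
  nth 0%MM (merge_ends w) j =
  if (j == 0)%N then (nth 0 w (size w).-1 + nth 0 w 0%N)%MM else nth 0%MM w j.
Proof.
case: j => [|j] jw /=; first by rewrite nth_last nth0.
by rewrite nth_take ?nth_behead //; lia.
Qed.

Lemma encode_merge_at t i f : f \in onto n t.+1 -> (i < t)%N ->
  merge_at i (encode t.+1 f) = encode t (face t i f).
Proof.
move=> fW it; apply: (@eq_from_nth _ 0%MM) => [|j].
  by rewrite size_merge_at !size_encode.
rewrite size_merge_at size_encode //= => jt; rewrite nth_merge_at ?size_encode //.
rewrite !nth_encode; [|lia..].
apply/mnmP => v; rewrite letter_mnmE face_inner //.
by case: (ltngtP j i) => [ji|ij|->]; rewrite ?mnmDE !letter_mnmE; lia.
Qed.

Lemma encode_merge_ends t f : f \in onto n t.+1 -> (0 < t)%N ->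
  merge_ends (encode t.+1 f) = encode t (face t t f).
Proof.
move=> fW t_gt0; apply: (@eq_from_nth _ 0%MM) => [|j].
  by rewrite size_merge_ends !size_encode.
rewrite size_merge_ends size_encode //= => jt; rewrite nth_merge_ends ?size_encode //=.
rewrite !nth_encode; [|lia..].
apply/mnmP => v; rewrite letter_mnmE face_last //.
have [->|j0] := eqVneq j 0%N; rewrite ?mnmDE !letter_mnmE.
  by case: (eqVneq (f v : nat) t); lia.
by case: (eqVneq (f v : nat) t); lia.
Qed.

Lemma word_boundaryE t (w : word R H t.+1) (w' : word R H t) :
  word_boundary R H t.+1 (letters w) w' =
  \sum_(i < t.+1) (-1) ^+ i * (face t i (placement_of w) == placement_of w')%:R.
Proof.
(* The existence of [w'] excludes the zero branch of [word_boundary]. *)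
have t_gt0 := onto_gt0 (placement_of_onto w'); have wW := placement_of_onto w.
rewrite /word_boundary ltnS leqNgt t_gt0 /= ffunE big_ord_recr /=; congr (_ + _).
  rewrite sum_ffunE; apply: eq_bigr => i _; rewrite !ffunE /GRing.scale /=.
  rewrite -(encode_placement_of w) encode_merge_at //.
  rewrite letters_encode ?face_onto //; last exact: ltnW.
  by rewrite eq_sym.
rewrite !ffunE /GRing.scale /= -(encode_placement_of w) encode_merge_ends //.
by rewrite letters_encode ?face_onto // eq_sym 2!exprS !mulN1r opprK.
Qed.

Definition restrict_fun s (c : placement_chain F n) : chain R H s :=
  [ffun w => c (placement_of w)].

Lemma restrict_fun_linear s : linear (restrict_fun s).
Proof. by move=> a c d; apply/ffunP => w; rewrite !ffunE. Qed.

HB.instance Definition _ s :=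
  GRing.isLinear.Build R[i] (placement_chain F n) (chain R H s) _ (restrict_fun s)
    (restrict_fun_linear s).

Definition restrict s : 'Hom(placement_chain F n, chain R H s) := linfun (restrict_fun s).

Lemma restrictE s c w : restrict s c w = c (placement_of w).
Proof. by rewrite lfunE /= ffunE. Qed.

Lemma boundary_restrict t (c : placement_chain F n) : c \in supported F (uncrowded t.+1) ->
  boundary R H t.+1 (restrict t.+1 c) = restrict t (bd F t (uncrowded t) c).
Proof.
move=> /supportedP cU; apply/ffunP => w'; rewrite boundaryE restrictE bdE.
rewrite placement_of_uncrowded /boundary_fun sum_ffunE.
pose G f : F := \sum_(i < t.+1)
    (c f : F) * ((-1) ^+ i * (face t i f == placement_of w')%:R).
transitivity (\sum_(w : word R H t.+1) G (placement_of w)).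
  apply: eq_bigr => w _; rewrite ffunE restrictE word_boundaryE /GRing.scale /=.
  by rewrite mulr_sumr.
rewrite (sum_placement_of t.+1 G) exchange_big /=; apply: eq_bigr => i _.
rewrite mulr_sumr [RHS]big_mkcond [LHS]big_mkcond; apply: eq_bigr => f _.
have [fU|fU] := boolP (f \in uncrowded t.+1).
  rewrite (subsetP (uncrowded_onto _) _ fU) /=.
  by case: eqP; rewrite ?mulr1 ?mulr0 // mulrC.
by rewrite (cU f fU) mulr0 if_same.
Qed.

Lemma restrict_inj s : (supported F (uncrowded s) :&: lker (restrict s) = 0)%VS.
Proof.
apply: cap_lker0 => c /supportedP cU rc; apply/ffunP => f; rewrite ffunE.
have [/placement_of_surj[w <-]|/cU//] := boolP (f \in uncrowded s).
by rewrite -restrictE rc ffunE.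
Qed.

Lemma restrict_full s : (restrict s @: supported F (uncrowded s))%VS = fullv.
Proof.
apply: limg_full => b.
exists [ffun f => if [pick w | placement_of w == f] is Some w then b w else 0].
  apply/supportedP => f fU; rewrite ffunE; case: pickP => // w /eqP wf.
  by rewrite -wf placement_of_uncrowded in fU.
apply/ffunP => w; rewrite restrictE ffunE; case: pickP => [w' /eqP/placement_of_inj ->|] //.
by move=> /(_ w); rewrite eqxx.
Qed.

(** Without crowded words in the middle degree the two truncated boundaries compose to zero. Here
    [t] is the dimension of the cells, one less than the number of letters. *)
Lemma homology_dim t (r : int) : r = t%:Z - 1 -> uncrowded t.+1 = onto n t.+1 ->
  (cyclic_homology_dim R H r
   + \dim (bd F t (uncrowded t) @: supported F (uncrowded t.+1))
   + \dim (bd F t.+1 (uncrowded t.+1) @: supported F (uncrowded t.+2)))%N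
  = #|onto n t.+1|.
Proof.
move=> -> tU; rewrite /cyclic_homology_dim (_ : absz _ = t.+1); last lia.
rewrite -tU -(dim_supported F).
apply: (dim_homology_comparison (restrict_full t.+2) (restrict_full t.+1)
  (restrict_inj t.+1) (restrict_inj t) (fun c => bd_supported t.+1 _ c)
  (fun c => bd_supported t _ c) (@boundary_restrict t.+1) (@boundary_restrict t)).
by move=> c; rewrite tU bd_bd_sub // uncrowded_onto.
Qed.

End Transport.

(** * Dimension count for the quotient complex *)

Section Count.

Variables (F : numFieldType) (n k : nat).

Lemma homology_count t m :
  (m + \dim (bd F t (onto n t) @: supported F (onto n t.+1))
     + \dim (bd F t.+1 (onto n t.+1) @: supported F (onto n t.+2)))%N = #|onto n t.+1| ->
  m = #|sorted_words n 0 t.+1|.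
Proof.
have := dim_cycles_rank F n t; rewrite dim_cycles /boundaries.
set x := \dim (bd F t.+1 _ @: _)%VS; set y := \dim (bd F t _ @: _)%VS.
set a := #|sorted_words n 0 _|; set b := #|onto _ _|.
by move: x y a b => x y a b; lia.
Qed.

(** Only the outgoing boundary feels the crowded words: it is the full one followed by [cut_fun],
    and the rank lost there reappears as homology. *)
Lemma homology_count_crowded d m : (d.+1 + k = n.+2)%N -> (3 <= k)%N ->
  (m + \dim (bd F d.+1 (uncrowded n k d.+1) @: supported F (onto n d.+2))
     + \dim (bd F d.+2 (onto n d.+2) @: supported F (onto n d.+3)))%N = #|onto n d.+2| ->
  m = (#|sorted_words n 0 d.+2| + #|sorted_words n 1 d.+1|)%N.
Proof.
move=> dk k_ge3.
have -> : (bd F d.+1 (uncrowded n k d.+1) @: supported F (onto n d.+2) =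
    linfun (cut_fun (crowded n k d.+1)) @: boundaries F n d)%VS.
  rewrite /boundaries -limg_comp; apply: eq_in_limg => c _; apply/ffunP => g.
  rewrite bd_restrict ?uncrowded_onto // comp_lfunE [in RHS]lfunE /= ffunE in_setD.
  case: (boolP (g \in crowded n k d.+1)) => //= gC.
  by case: ifPn => // gW; rewrite bdE (negPf gW).
have := dim_boundaries_cut dk k_ge3 F; have := dim_cycles_rank F n d.+1.
rewrite dim_cycles -/(boundaries F n d) -/(boundaries F n d.+1).
set x := \dim (_ @: boundaries F n d)%VS; set y := \dim (boundaries F n d).
set z := \dim (boundaries F n d.+1).
set a := #|sorted_words n 0 _|; set b := #|sorted_words n 1 _|; set c := #|onto _ _|.
by move: x y z a b c => {dk k_ge3} x y z a b c; lia.
Qed.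

Lemma uncrowded_full s : (n.+2 < s + k)%N -> uncrowded n k s = onto n s.
Proof.
move=> nsk; apply/setDidPl; rewrite disjoint_sym disjoints_subset.
apply/subsetP => f fC; case: (crowded_n_lt fC nsk).
Qed.

Lemma uncrowded_0 : uncrowded n k 0 = onto n 0.
Proof. by apply/setP => f; rewrite in_setD andb_idl // => /onto_gt0. Qed.

End Count.

Section Homology.

Variables (R : realType) (n k t : nat) (r : int).
Hypothesis rt : r = t%:Z - 1.
Local Notation H := (complete_uniform n.+1 k).

Lemma homology_full : (t <= n)%N -> (forall s, (t <= s)%N -> uncrowded n k s = onto n s) ->
  cyclic_homology_dim R H r = 'C(n, t).
Proof.
move=> tn full; have := homology_dim R rt (full t.+1 (leqnSn t)).
rewrite (full t) // (full t.+1) // (full t.+2); last lia.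
move/homology_count => ->.
by rewrite card_sorted_words // subn1.
Qed.

Lemma homology_crowded : (t + k)%N = n.+2 -> (0 < t)%N -> (3 <= k)%N ->
  cyclic_homology_dim R H r = ('C(n, t) + #|sorted_words n 1 t|)%N.
Proof.
move=> tk t_gt0 k_ge3; have full s : (t < s)%N -> uncrowded n k s = onto n s.
  by move=> ts; apply: uncrowded_full; lia.
have := homology_dim R rt (full t.+1 (ltnSn t)).
rewrite (full t.+1) // (full t.+2); last lia.
have td : t = t.-1.+1 by rewrite prednK.
rewrite td in tk *; move/(homology_count_crowded tk k_ge3) => ->.
by rewrite card_sorted_words ?subn1 //; lia.
Qed.

End Homology.

Theorem corollary3p3 (R : realType) (n k : nat) (r : int)
    (n_gt0 : (0 < n)%N) (k_ge3 : (3 <= k)%N) (r_ge : -1 <= r) :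
  (n%:Z - k%:Z < r <= n%:Z - 2 ->
     cyclic_homology_dim R (complete_uniform n k) r = binz n.-1 (r + 1))
  /\
  (r = n%:Z - k%:Z ->
     cyclic_homology_dim R (complete_uniform n k) r =
       (binz n.-1 (n%:Z - k%:Z - 1) + binz n.-1 (n%:Z - k%:Z + 1))%N).
Proof.
case: n n_gt0 => // n _ /=.
pose t := absz (r + 1); have rt : r = t%:Z - 1 by rewrite /t; lia.
split=> [/andP[rk rn]|rk].
  have -> : r + 1 = t by lia.
  by rewrite (homology_full R rt) => [//||s ts]; [lia|apply: uncrowded_full; lia].
have tk : (t + k)%N = n.+2 by lia.
have -> : n.+1%:Z - k%:Z + 1 = t by lia.
(* For [t = 0], [k] exceeds the number of vertices by one: there are no hyperedges, and the lower
   index -2 gives 0. *)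
have [t0|t_gt0] := posnP t.
  have -> : n.+1%:Z - k%:Z - 1 = Negz 1 by lia.
  rewrite (homology_full R rt) => [//||s ts]; first lia.
  have [->|s_gt0] := posnP s; first exact: uncrowded_0.
  by apply: uncrowded_full; lia.
rewrite (homology_crowded R rt tk t_gt0 k_ge3) /= addnC; congr (_ + _)%N.
(* For [t = 1] the only hyperedge is the whole vertex set; a word with one letter has every vertex
   at position 0, so none is sorted with [p = 1]. *)
have [t1|t_gt1] : t = 1%N \/ (1 < t)%N by lia.
  have -> : n.+1%:Z - k%:Z - 1 = Negz 0 by lia.
  rewrite /= t1; apply: eq_card0 => f; apply/sorted_wordsP => -[fW _ z].
  have := z ord_max; rewrite (onto_lt ord_max fW) => /(_ isT)/(congr1 val) /=; lia.
have -> : n.+1%:Z - k%:Z - 1 = (t - 2)%N by lia.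
by rewrite card_sorted_words //; lia.
Qed.
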